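(* Let $\mathcal{C}$ be a category with finite products, $k$ a field of characteristic $0$, and $H^{\bullet} : \mathcal{C}^{\mathrm{op}} \to \mathbf{GrVec}_{k}$ a functor satisfying Axiom 1 (cup product), Axiom 2 (K\''unneth formula) and Axiom 3 (finite-dimensionality) stated in the context. Let $X$ be an object of $\mathcal{C}$ and $\phi = \bigoplus_{i\ge 0}\phi_i$ a $k$-linear graded endomorphism (of degree $0$) of $H^\bullet(X)$. Then, in $k[[u]][[t]]$, $$\sum_{n=0}^{\infty}L_{u}\left(\phi_{X^{n}}|_{H^{\bullet}(X^{n})^{A_{n}}}\right) t^{n} = \sum_{n=0}^{\infty}L_{u}\left(\phi_{X^{n}}|_{H^{\bullet}(X^{n})^{S_{n}}}\right) t^{n} + \frac{1}{\sum_{n=0}^{\infty}L_{u}\left(\phi_{X^{n}}|_{H^{\bullet}(X^{n})^{S_{n}}}\right) (-t)^{n}} - 1 - L_{u}(\phi)\,t.$$ If moreover $\dim_{k}(H^{\bullet}(X))$ is finite, so that $H^{i}(X) = 0$ for all $i > 2d$ for some $d$, then $$\sum_{n=0}^{\infty}L_{u}\left(\phi_{X^{n}}|_{H^{\bullet}(X^{n})^{A_{n}}}\right) t^{n} = \prod_{i=0}^{2d} \left( \frac{1}{\det(\mathrm{id}_{H^{i}(X)} - \phi_{i}u^{i}t)} \right)^{(-1)^{i}} + \prod_{i=0}^{2d} \left( \frac{1}{\det(\mathrm{id}_{H^{i}(X)} + \phi_{i}u^{i}t)} \right)^{(-1)^{i+1}} - 1 - L_{u}(\phi)\,t.$$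
   Context: $\mathbf{GrVec}_k$ is the category of $\mathbb{Z}_{\ge 0}$-graded $k$-vector spaces with $k$-linear graded maps of degree $0$. Write $H^\bullet(X) = \bigoplus_{i\geq 0} H^i(X)$, and $f^* : H^\bullet(Y) \to H^\bullet(X)$ for the map induced by a morphism $f : X \to Y$. Axiom 1: every object $X$ has a cup product, i.e. $k$-bilinear maps $\cup : H^i(X) \times H^j(X) \to H^{i+j}(X)$ for all $i,j \ge 0$ with $a \cup b = (-1)^{ij}\, b \cup a$ for $a \in H^i(X)$, $b \in H^j(X)$; the cup product is associative and natural, i.e. $f^*(a\cup b) = f^*(a)\cup f^*(b)$ for all morphisms $f$. Axiom 2 (K\''unneth formula): for all objects $X, Y$, with projections $p_X, p_Y$ from $X\times Y$, there is an isomorphism $H^\bullet(X \times Y) \simeq H^\bullet(X) \otimes_k H^\bullet(Y)$ given by $p_X^*(a) \cup p_Y^*(b) \mapsto a \otimes b$ for homogeneous $a, b$. Axiom 3: $H^i(X)$ is finite-dimensional over $k$ for every object $X$ and every $i$. These give $H^\bullet(X^n) \simeq H^\bullet(X)^{\otimes n}$ via $p_1^*(a_1) \cup \cdots \cup p_n^*(a_n) \mapsto a_1 \otimes \cdots \otimes a_n$, with $p_1,\dots,p_n : X^n \to X$ the projections. A subgroup $G \leqslant S_n$ acts on $X^n$ by permuting coordinates, and the induced linear action on $H^\bullet(X^n)$ is $g\cdot(p_1^*(a_1)\cup\cdots\cup p_n^*(a_n)) = p_{g(1)}^*(a_1)\cup\cdots\cup p_{g(n)}^*(a_n)$ for homogeneous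 $a_i$. $H^\bullet(X^n)^G$ is the graded subspace of $G$-invariants. $A_n \leqslant S_n$ is the alternating group ($A_0$, $A_1$ are trivial). A graded endomorphism $\phi$ of $H^\bullet(X)$ induces the graded endomorphism $\phi_{X^n}$ of $H^\bullet(X^n)$ given by $p_1^*(a_1)\cup\cdots\cup p_n^*(a_n) \mapsto p_1^*(\phi(a_1))\cup\cdots\cup p_n^*(\phi(a_n))$; it commutes with the $G$-action and so restricts to $\phi_{X^n}|_{H^\bullet(X^n)^G}$. For $n=0$, $H^\bullet(X)^{\otimes 0} = k$ in degree $0$, and the $n=0$ terms of the series are $1$. For a graded endomorphism $\psi = \bigoplus_i \psi_i$ of a graded vector space with finite-dimensional homogeneous pieces, the Lefschetz series is $L_u(\psi) := \sum_{i\geq 0}(-u)^i\,\mathrm{Tr}(\psi_i) \in k[[u]]$. *)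

(* Defs.v *)
From HB Require Import structures.
From mathcomp Require Import all_boot all_order all_algebra all_fingroup all_solvable.
From mathcomp Require Import boolp classical_sets.

Set Implicit Arguments.
Unset Strict Implicit.
Unset Printing Implicit Defensive.

Import GRing.Theory.
Local Open Scope ring_scope.

(** * Formal power series in one variable *)

Record fps (R : Type) := Fps { fcoef : nat -> R }.

Lemma fpsP (R : Type) (f g : fps R) : fcoef f =1 fcoef g -> f = g.
Proof. by case: f g => [f] [g] /= /funext ->. Qed.

HB.instance Definition _ (R : Type) := gen_eqMixin (fps R).
HB.instance Definition _ (R : Type) := gen_choiceMixin (fps R).

Section FpsRing.
Variable R : comNzRingType.
Implicit Types f g h : fps R.

Definition fps_zero : fps R := Fps (fun=> 0).
Definition fps_opp f : fps R := Fps (fun n => - fcoef f n).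
Definition fps_add f g : fps R := Fps (fun n => fcoef f n + fcoef g n).
Definition fpsC (c : R) : fps R := Fps (fun n => if n == 0 then c else 0).
Definition fpsX : fps R := Fps (fun n => (n == 1)%:R).
Definition fps_mul f g : fps R :=
  Fps (fun n => \sum_(j < n.+1) fcoef f j * fcoef g (n - j)).

Fact fps_addA : associative fps_add.
Proof. by move=> f g h; apply: fpsP => n /=; rewrite addrA. Qed.
Fact fps_addC : commutative fps_add.
Proof. by move=> f g; apply: fpsP => n /=; rewrite addrC. Qed.
Fact fps_add0 : left_id fps_zero fps_add.
Proof. by move=> f; apply: fpsP => n /=; rewrite add0r. Qed.
Fact fps_addN : left_inverse fps_zero fps_opp fps_add.
Proof. by move=> f; apply: fpsP => n /=; rewrite addNr. Qed.

HB.instance Definition _ :=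
  GRing.isZmodule.Build (fps R) fps_addA fps_addC fps_add0 fps_addN.

Let trunc m f : {poly R} := \poly_(i < m) fcoef f i.

Let trunc_mul m f g n : (n < m)%N ->
  fcoef (fps_mul f g) n = (trunc m f * trunc m g)`_n.
Proof.
move=> lt_nm; rewrite coefM /=; apply: eq_bigr => i _; rewrite !coef_poly.
have le_in : (i <= n)%N by rewrite -ltnS.
by rewrite (leq_ltn_trans le_in lt_nm) (leq_ltn_trans (leq_subr i n) lt_nm).
Qed.

Fact fps_mulC : commutative fps_mul.
Proof.
by move=> f g; apply: fpsP => n; rewrite !(@trunc_mul n.+1) // mulrC.
Qed.

Fact fps_mulA : associative fps_mul.
Proof.
have aux f g h n : fcoef (fps_mul (fps_mul f g) h) n
    = (trunc n.+1 f * trunc n.+1 g * trunc n.+1 h)`_n.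
  rewrite coefM; apply: eq_bigr => i _; have lt_in := ltn_ord i.
  rewrite (@trunc_mul n.+1) // [(trunc _ h)`_ _]coef_poly.
  by rewrite ltnS leq_subr.
move=> f g h; apply: fpsP => n.
by rewrite fps_mulC !aux mulrC mulrA.
Qed.

Fact fps_mul1 : left_id (fpsC 1) fps_mul.
Proof.
move=> f; apply: fpsP => n /=.
rewrite big_ord_recl /= mul1r subn0 big1 ?addr0 // => i _.
by rewrite mul0r.
Qed.

Fact fps_mulDl : left_distributive fps_mul fps_add.
Proof.
move=> f g h; apply: fpsP => n /=.
by rewrite -big_split; apply: eq_bigr => i _; rewrite mulrDl.
Qed.

Fact fps_oner_neq0 : fpsC 1 != fps_zero.
Proof.
apply/eqP => /(congr1 (fun f => fcoef f 0)) /= /eqP.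
by rewrite oner_eq0.
Qed.

HB.instance Definition _ := GRing.Zmodule_isComNzRing.Build (fps R)
  fps_mulA fps_mulC fps_mul1 fps_mulDl fps_oner_neq0.

(* [f^-1] is the multiplicative inverse of [f] when there is one, else [f]. *)
Definition fps_unit : pred (fps R) := fun f => `[< exists g : fps R, g * f = 1 >].
Definition fps_inv f : fps R := xget f [set g : fps R | g * f = 1]%classic.

Fact fps_mulV : {in fps_unit, left_inverse 1 fps_inv *%R}.
Proof. move=> f /asboolP [g gf1].
exact: (@xgetPex _ f [set h | h * f = 1]%classic (ex_intro _ g gf1)). Qed.
Fact fps_unitP f g : g * f = 1 -> fps_unit f.
Proof. by move=> gf1; apply/asboolP; exists g. Qed.
Fact fps_inv_out : {in [predC fps_unit], fps_inv =1 id}.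
Proof.
move=> f; rewrite inE => /asboolP nf; apply: xgetPN => g gf1.
by apply: nf; exists g.
Qed.

HB.instance Definition _ := GRing.ComNzRing_hasMulInverse.Build (fps R)
  fps_mulV fps_unitP fps_inv_out.

End FpsRing.

Arguments fpsX {R}.

(** * Categories with finite products *)

Record category := Category {
  obj :> Type;
  mor : obj -> obj -> Type;
  idm : forall X, mor X X;
  cmp : forall X Y Z, mor Y Z -> mor X Y -> mor X Z;
  cmp1m : forall X Y (f : mor X Y), cmp (idm Y) f = f;
  cmpm1 : forall X Y (f : mor X Y), cmp f (idm X) = f;
  cmpA : forall X Y Z T (h : mor Z T) (g : mor Y Z) (f : mor X Y),
    cmp h (cmp g f) = cmp (cmp h g) f
}.
Arguments mor {_}.
Arguments idm {_}.
Arguments cmp {_ X Y Z}.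

Record fpCategory := FpCategory {
  fpcat :> category;
  fprod : forall I : finType, (I -> fpcat) -> fpcat;
  fproj : forall (I : finType) (F : I -> fpcat) (i : I), mor (fprod F) (F i);
  ftuple : forall (I : finType) (F : I -> fpcat) (Z : fpcat),
    (forall i, mor Z (F i)) -> mor Z (fprod F);
  fproj_tuple : forall (I : finType) (F : I -> fpcat) (Z : fpcat)
    (f : forall i, mor Z (F i)) i, cmp (fproj F i) (ftuple f) = f i;
  ftuple_uniq : forall (I : finType) (F : I -> fpcat) (Z : fpcat)
    (f : forall i, mor Z (F i)) (h : mor Z (fprod F)),
    (forall i, cmp (fproj F i) h = f i) -> h = ftuple f
}.
Arguments fprod {_ I}.
Arguments fproj {_ I F}.
Arguments ftuple {_ I F Z}.

Section Products.
Variable C : fpCategory.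

Definition prod2 (X Y : C) : C := fprod (fun b : bool => if b then X else Y).
Definition pr1 (X Y : C) : mor (prod2 X Y) X := fproj true.
Definition pr2 (X Y : C) : mor (prod2 X Y) Y := fproj false.

Definition pow (X : C) (n : nat) : C := fprod (fun _ : 'I_n => X).
Definition ppr (X : C) (n : nat) (i : 'I_n) : mor (pow X n) X := fproj i.

Definition pperm (X : C) (n : nat) (g : 'S_n) : mor (pow X n) (pow X n) :=
  ftuple (fun i => ppr X (g i)).

End Products.

(** * Graded vector spaces *)

Section Graded.
Variable k : fieldType.

(* Graded vector spaces with finite-dimensional homogeneous pieces: a [vectType]
   is a finite-dimensional vector space. *)
Definition grvec : Type := nat -> vectType k.
Definition grhom (V W : grvec) : Type := forall i, 'Hom(V i, W i).

(* Homogeneous elements, bundled with their degree, so that equations between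
   elements of degrees [i + j] and [j + i] can be written without transport. *)
Definition homog (V : grvec) : Type := {i : nat & V i}.
Definition hom_el (V : grvec) (i : nat) (x : V i) : homog V := existT _ i x.
Definition homog_map (V W : grvec) (f : grhom V W) (a : homog V) : homog W :=
  hom_el (f (tag a) (tagged a)).
Definition homog_scale (V : grvec) (c : k) (a : homog V) : homog V :=
  hom_el (c *: tagged a).

Definition grbilin (U V W : grvec) : Type :=
  forall i j, {bilinear U i -> V j -> W (i + j)%N}.

(* [T] together with [t : (x, y) |-> x (x) y] is the graded tensor product of [U]
   and [V]. *)
Definition is_tensor (U V T : grvec) (t : grbilin U V T) : Prop :=
  forall (W : grvec) (b : grbilin U V W),
    exists! h : grhom T W,
      forall i j (x : U i) (y : V j), h (i + j)%N (t i j x y) = b i j x y.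

Definition end_mx (V : vectType k) (f : 'End(V)) : 'M[k]_(\dim {: V}) :=
  passmx.mxof (vbasis {: V}) (vbasis {: V}) f.
Definition ltrace (V : vectType k) (f : 'End(V)) : k := \tr (end_mx f).

Definition lefschetz (V : grvec) (psi : grhom V V) : fps k :=
  Fps (fun i => (-1) ^+ i * ltrace (psi i)).

Definition subgr (V : grvec) (U : forall i, {vspace V i}) : grvec :=
  fun i => subvs_of (U i).
(* The restriction of [psi] to [U], when [psi] maps [U] to itself. *)
Definition restr (V : grvec) (psi : grhom V V) (U : forall i, {vspace V i}) :
    grhom (subgr U) (subgr U) :=
  fun i => (linfun (vsproj (U i)) \o psi i \o linfun (vsval : subvs_of (U i) -> V i))%VF.

(* The dimension of the direct sum of the [V i] is finite. *)
Definition dim_finite (V : grvec) : Prop :=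
  exists N, forall m, (\sum_(i < m) \dim {: V i} <= N)%N.

(* The matrix of [f], with entries viewed as constants of [k[[u]][[t]]]. *)
Definition fps_mx (V : vectType k) (f : 'End(V)) : 'M[fps (fps k)]_(\dim {: V}) :=
  map_mx (fun x => fpsC (fpsC x)) (end_mx f).

End Graded.

(** * Cohomology theories *)

Record cohFunctor (C : category) (k : fieldType) := CohFunctor {
  coh :> C -> grvec k;
  pull : forall X Y : C, mor X Y -> grhom (coh Y) (coh X);
  pull_id : forall (X : C) i, pull (idm X) i = \1%VF;
  pull_cmp : forall (X Y Z : C) (g : mor Y Z) (f : mor X Y) i,
    pull (cmp g f) i = (pull f i \o pull g i)%VF
}.
Arguments pull {C k} c {X Y}.

Definition hcup_of (k : fieldType) (V : grvec k) (m : grbilin V V V)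
    (a b : homog V) : homog V :=
  hom_el (m (tag a) (tag b) (tagged a) (tagged b)).

Record cupProduct (C : category) (k : fieldType) (H : cohFunctor C k) := CupProduct {
  cup : forall X : C, grbilin (H X) (H X) (H X);
  cupC : forall (X : C) (a b : homog (H X)),
    hcup_of (cup X) a b
    = homog_scale ((-1) ^+ (tag a * tag b)) (hcup_of (cup X) b a);
  cupA : forall (X : C) (a b c : homog (H X)),
    hcup_of (cup X) a (hcup_of (cup X) b c)
    = hcup_of (cup X) (hcup_of (cup X) a b) c;
  cup_pull : forall (X Y : C) (f : mor X Y) i j (a : H Y i) (b : H Y j),
    pull H f (i + j)%N (cup Y i j a b)
    = cup X i j (pull H f i a) (pull H f j b)
}.

Section Cohomology.
Variables (C : fpCategory) (k : fieldType) (H : cohFunctor C k).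
Variable cp : cupProduct H.

Definition hcup (X : C) : homog (H X) -> homog (H X) -> homog (H X) :=
  hcup_of (cup cp X).

Definition hpull (X Y : C) (f : mor X Y) : homog (H Y) -> homog (H X) :=
  homog_map (pull H f).

Definition kunneth : Prop :=
  forall X Y : C,
  exists (T : grvec k) (t : grbilin (H X) (H Y) T),
    is_tensor t /\
    exists h : grhom (H (prod2 X Y)) T,
      (forall m, bijective (h m)) /\
      forall i j (a : H X i) (b : H Y j),
        h (i + j)%N (cup cp _ i j (pull H (pr1 X Y) i a) (pull H (pr2 X Y) j b))
        = t i j a b.

(* a_0 \cup ... \cup a_n *)
Fixpoint cups (X : C) (n : nat) : ('I_n.+1 -> homog (H X)) -> homog (H X) :=
  match n with
  | 0 => fun a => a ord0
  | n'.+1 => fun a => hcup (cups (fun i : 'I_n'.+1 => a (widen_ord (leqnSn _) i)))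
                           (a ord_max)
  end.

Definition induces (X : C) (phi : grhom (H X) (H X)) (n : nat)
    (Phi : grhom (H (pow X n.+1)) (H (pow X n.+1))) : Prop :=
  forall a : 'I_n.+1 -> homog (H X),
    homog_map Phi (cups (fun i => hpull (ppr X i) (a i)))
    = cups (fun i => hpull (ppr X i) (homog_map phi (a i))).

(* phi_{X^(n+1)}: by the Künneth formula there is exactly one [Phi] such that
   [induces phi Phi]. *)
Definition induced (X : C) (phi : grhom (H X) (H X)) (n : nat) :
    grhom (H (pow X n.+1)) (H (pow X n.+1)) :=
  xget (fun i => 0) [set Phi | induces phi Phi]%classic.

Definition invariants (X : C) (n : nat) (G : {set 'S_n}) (i : nat) :
    {vspace H (pow X n) i} :=
  (\bigcap_(g in G) fixedSpace (pull H (pperm X g) i))%VS.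

(* sum_n L_u(phi_{X^n} | H(X^n)^(G n)) t^n, whose term at n = 0 is 1 by
   convention. *)
Definition lefschetz_series (X : C) (phi : grhom (H X) (H X))
    (G : forall n, {set 'S_n}) : fps (fps k) :=
  Fps (fun n => if n is n'.+1
                then lefschetz (restr (induced phi n') (invariants X (G n'.+1)))
                else 1).

End Cohomology.

(* f(t) |-> f(-t) *)
Definition subst_opp (R : comNzRingType) (f : fps R) : fps R :=
  Fps (fun n => (-1) ^+ n * fcoef f n).

(* Main.v *)
Require Import Defs.
From HB Require Import structures.
From mathcomp Require Import all_boot all_order all_algebra all_fingroup all_solvable.
From mathcomp Require classical_sets.
From mathcomp Require Import boolp ring.

Set Implicit Arguments.
Unset Strict Implicit.
Unset Printing Implicit Defensive.

Import GRing.Theory.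
Local Open Scope ring_scope.

(** Let [p_l = sum_i (-1)^i tr(phi_i^l) u^(i l)] be the super power sums of [phi],
    and for [eta = 1] or [eta = -1] let
      [c_n = 1/n! * sum_(g in S_n) eta^(g odd) L_u(g o phi_(X^n))],
    the Lefschetz series of [phi_(X^n)] on the invariants ([eta = 1]) or on the
    sign-isotypic part ([eta = -1]) of [H(X^n)].

    The supertrace of [g o phi_(X^n)] is a product over the cycles of [g], a cycle
    of length [l] contributing [p_l]; summing over [g] gives the Newton recursion
      [(n+1) c_(n+1) = sum_j eta^j p_(j+1) c_(n-j)].
    For the generating series [S] and [E] of the two cases this says that the
    logarithmic derivatives [t S'/S] and [t E'/E] are [P(t)] and [-P(-t)], where
    [P(t) = sum_(l > 0) p_l t^l].  Hence [S(-t) E(t)] has derivative zero and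
    constant term one, so [E = 1 / S(-t)] ([twisted_inverse]).  For [n > 1] the
    mean over [A_n] is twice the mean over [S_n] restricted to even permutations,
    so the coefficients of the alternating series are those of [S + E]; in degrees
    [0] and [1], where [A_n = S_n], the surplus is [1] and [L_u(phi) t]
    ([Alt_series]).  The determinants enter through the same differential
    equation: [t d/dt] of [det(1 - t B)] is [-(sum_(l > 0) tr(B^l) t^l) det(1 - t B)]
    ([tderiv_charseries]), and solutions with a given constant term are unique in
    characteristic zero ([tderiv_uniq]).

    Two points need work.  The Kunneth formula is a universal property; it is used
    to build, for each word [w] of basis vectors of [H(X)], a linear form on
    [H(X^n)] dual to the cup product of the letters ([word_coord]), and to show
    that these cup products span ([word_resolution]), so that traces become sums
    over words.  The sign by which a permutation reorders a cup product is, for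
    permutations preserving degrees, the sign of its restriction to the factors of
    odd degree ([cups_perm_stable]).  The Newton recursion is then obtained without
    cycle decompositions: the matrices sitting at the [n] positions are allowed to
    differ, and deleting a position from a permutation multiplies its matrix into
    the one at the preceding position ([cyc_sum_lift]).  Infinitely many degrees of
    [H(X)] cause no trouble because the coefficient of [u^m] only involves letters
    of degree at most [m]. *)

(** * Formal power series *)

Section FpsTheory.
Variable R : comNzRingType.
Implicit Types (f g : fps R).

Lemma fcoefD f g n : fcoef (f + g) n = fcoef f n + fcoef g n. Proof. by []. Qed.
Lemma fcoefN f n : fcoef (- f) n = - fcoef f n. Proof. by []. Qed.
Lemma fcoefB f g n : fcoef (f - g) n = fcoef f n - fcoef g n. Proof. by []. Qed.
Lemma fcoef0 n : fcoef (0 : fps R) n = 0. Proof. by []. Qed.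
Lemma fcoefC (c : R) n : fcoef (fpsC c) n = if n == 0 then c else 0. Proof. by []. Qed.
Lemma fcoef1 n : fcoef (1 : fps R) n = (n == 0)%:R.
Proof. by rewrite [LHS]/=; case: eqP. Qed.
Lemma fcoefM f g n :
  fcoef (f * g) n = \sum_(j < n.+1) fcoef f j * fcoef g (n - j).
Proof. by []. Qed.

Lemma fcoef_sum (I : Type) (r : seq I) (P : pred I) (F : I -> fps R) n :
  fcoef (\sum_(i <- r | P i) F i) n = \sum_(i <- r | P i) fcoef (F i) n.
Proof. by apply: (big_morph (fun f => fcoef f n)). Qed.

Lemma fcoefMn f m n : fcoef (f *+ m) n = fcoef f n *+ m.
Proof. by elim: m => [|m IH]; rewrite ?mulr0n // !mulrS fcoefD IH. Qed.

Lemma fpsC_is_additive : zmod_morphism (@fpsC R).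
Proof. by move=> x y; apply: fpsP => n /=; case: eqP => //; rewrite subr0. Qed.

Lemma fpsC_is_monoid_morphism : monoid_morphism (@fpsC R).
Proof.
split=> // x y; apply: fpsP => n; rewrite fcoefM big_ord_recl /= subn0.
rewrite big1 => [|i _]; last by rewrite mul0r.
by case: eqP => _; rewrite ?mulr0 addr0.
Qed.

HB.instance Definition _ :=
  GRing.isZmodMorphism.Build R (fps R) (@fpsC R) fpsC_is_additive.
HB.instance Definition _ :=
  GRing.isMonoidMorphism.Build R (fps R) (@fpsC R) fpsC_is_monoid_morphism.

Lemma fcoefCM (c : R) f n : fcoef (fpsC c * f) n = c * fcoef f n.
Proof.
rewrite fcoefM big_ord_recl /= subn0 big1 ?addr0 // => i _.
by rewrite mul0r.
Qed.

Lemma fcoefXM f n : fcoef (fpsX * f) n = if n is m.+1 then fcoef f m else 0.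
Proof.
case: n => [|n]; rewrite fcoefM big_ord_recl /= mul0r add0r ?big_ord0 //.
rewrite big_ord_recl /= mul1r big1 ?addr0 => [|i _]; last by rewrite mul0r.
by rewrite subSS subn0.
Qed.

Lemma fcoefXnM f m n :
  fcoef (fpsX ^+ m * f) n = if (m <= n)%N then fcoef f (n - m) else 0.
Proof.
elim: m n => [|m IH] n; first by rewrite expr0 mul1r leq0n subn0.
by rewrite exprS -mulrA fcoefXM; case: n => [|n] //; rewrite IH ltnS subSS.
Qed.

Lemma fcoefXnC m (c : R) n :
  fcoef (fpsX ^+ m * fpsC c) n = if m == n then c else 0.
Proof.
rewrite fcoefXnM fcoefC; have [<-|ne] := eqVneq m n; first by rewrite leqnn subnn.
by case: ifP => // le_mn; rewrite subn_eq0 leqNgt ltn_neqAle ne le_mn.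
Qed.

Lemma fcoef_signM n f m : fcoef ((-1) ^+ n * f) m = (-1) ^+ n * fcoef f m.
Proof. by rewrite -fcoefCM rmorphXn rmorphN1. Qed.

Lemma fcoef0M f g : fcoef (f * g) 0 = fcoef f 0 * fcoef g 0.
Proof. by rewrite fcoefM big_ord1. Qed.

Definition const_coef f : R := fcoef f 0.

Lemma const_coef_is_additive : zmod_morphism const_coef.
Proof. by []. Qed.

Lemma const_coef_is_monoid_morphism : monoid_morphism const_coef.
Proof. by split=> // f g; apply: fcoef0M. Qed.

HB.instance Definition _ := GRing.isZmodMorphism.Build (fps R) R
  const_coef const_coef_is_additive.
HB.instance Definition _ := GRing.isMonoidMorphism.Build (fps R) R
  const_coef const_coef_is_monoid_morphism.

Lemma subst_opp_is_additive : zmod_morphism (@subst_opp R).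
Proof. by move=> f g; apply: fpsP => n; rewrite /= mulrBr. Qed.

Lemma subst_opp_is_monoid_morphism : monoid_morphism (@subst_opp R).
Proof.
split=> [|f g].
  by apply: fpsP => -[|n]; rewrite /= ?mulr1 ?mulr0.
apply: fpsP => n; rewrite [LHS]/= fcoefM mulr_sumr; apply: eq_bigr => j _.
by rewrite /= mulrACA -exprD subnKC // -ltnS.
Qed.

HB.instance Definition _ := GRing.isZmodMorphism.Build (fps R) (fps R)
  (@subst_opp R) subst_opp_is_additive.
HB.instance Definition _ := GRing.isMonoidMorphism.Build (fps R) (fps R)
  (@subst_opp R) subst_opp_is_monoid_morphism.

Lemma subst_opp0 f : fcoef (subst_opp f) 0 = fcoef f 0.
Proof. exact: mul1r. Qed.

(** [t d/dt]. *)
Definition tderiv f : fps R := Fps (fun n => fcoef f n *+ n).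

Lemma tderivD f g : tderiv (f + g) = tderiv f + tderiv g.
Proof. by apply: fpsP => n /=; rewrite mulrnDl. Qed.

Lemma tderivB f g : tderiv (f - g) = tderiv f - tderiv g.
Proof. by apply: fpsP => n /=; rewrite mulrnBl. Qed.

Lemma tderivM f g : tderiv (f * g) = tderiv f * g + f * tderiv g.
Proof.
apply: fpsP => n; rewrite fcoefD !fcoefM -big_split /= -sumrMnl.
apply: eq_bigr => j _; rewrite mulrnAl mulrnAr -mulrnDr subnKC //.
by rewrite -ltnS.
Qed.

Lemma tderivC (c : R) : tderiv (fpsC c) = 0.
Proof. by apply: fpsP => -[|n] /=; rewrite ?mul0rn. Qed.

Lemma tderiv0 : tderiv 0 = 0.
Proof. by apply: fpsP => n /=; exact: mul0rn. Qed.

Lemma tderiv1 : tderiv 1 = 0. Proof. exact: tderivC. Qed.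

Lemma tderiv_subst_opp f : tderiv (subst_opp f) = subst_opp (tderiv f).
Proof. by apply: fpsP => n /=; rewrite mulrnAr. Qed.

Lemma tderiv_sum (I : Type) (r : seq I) (P : pred I) (F : I -> fps R) :
  tderiv (\sum_(i <- r | P i) F i) = \sum_(i <- r | P i) tderiv (F i).
Proof. exact: (big_morph tderiv tderivD tderiv0). Qed.

Lemma tderiv_prod (I : finType) (F : I -> fps R) :
  tderiv (\prod_i F i) = \sum_i tderiv (F i) * \prod_(j | j != i) F j.
Proof.
suff gen (r : seq I) : uniq r -> tderiv (\prod_(i <- r) F i) =
    \sum_(i <- r) tderiv (F i) * \prod_(j <- r | j != i) F j.
  by apply: gen; apply: index_enum_uniq.
elim: r => [|i r IH] /=; first by rewrite !big_nil tderiv1.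
case/andP=> nir ur; rewrite !big_cons eqxx tderivM IH //; congr (_ + _).
  congr (_ * _); rewrite big_seq [in RHS]big_seq_cond; apply: eq_bigl => j.
  by case: eqP => [->|]; rewrite ?andbT // (negPf nir).
rewrite mulr_sumr !big_seq; apply: eq_bigr => j jr; rewrite mulrCA big_cons.
by case: eqP => // eij; rewrite eij jr in nir.
Qed.

(** Jacobi's formula. *)
Lemma tderiv_det n (A : 'M[fps R]_n) :
  tderiv (\det A) = \tr (map_mx tderiv A *m \adj A).
Proof.
transitivity (\sum_i \sum_j tderiv (A i j) * cofactor A i j); last first.
  rewrite /mxtrace; apply: eq_bigr => i _; rewrite mxE; apply: eq_bigr => j _.
  by rewrite !mxE.
transitivity (\sum_i \det (\matrix_(a, b) if a == i then tderiv (A a b) else A a b)).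
  rewrite /determinant tderiv_sum exchange_big /=; apply: eq_bigr => s _.
  rewrite tderivM (_ : tderiv (_ ^+ _) = 0) ?mul0r ?add0r; last first.
    by case: (odd_perm s); rewrite -?(rmorphN1 (@fpsC R)) ?expr0 ?tderivC ?tderiv1.
  rewrite tderiv_prod mulr_sumr; apply: eq_bigr => i _; congr (_ * _).
  rewrite [in RHS](bigD1 i) //= !mxE eqxx; congr (_ * _); apply: eq_bigr => j /negPf.
  by rewrite mxE => ->.
apply: eq_bigr => i _; rewrite (expand_det_row _ i); apply: eq_bigr => j _.
rewrite mxE eqxx; congr (_ * _); rewrite /cofactor; congr (_ * \det _).
by apply/matrixP => a b; rewrite !mxE eq_sym (negPf (neq_lift _ _)).
Qed.

End FpsTheory.

(** * Linear differential equations and characteristic series *)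

Section LogDerivative.
Variables (k : fieldType).
Hypothesis hk : [pchar k] =i pred0.
Implicit Types F G P : fps (fps k).

Lemma fps_mulrn_eq0 n (c : fps k) : c *+ n.+1 = 0 -> c = 0.
Proof.
move=> c0; apply: fpsP => m; have /(congr1 (fun f => fcoef f m)) := c0.
rewrite fcoefMn fcoef0 -mulr_natl => /eqP.
by rewrite mulf_eq0 ((pcharf0P k).1 hk) /= => /eqP.
Qed.

(** The coefficients of a solution of [t F' = P F] satisfy
    [n F_n = sum_(0 < j <= n) P_j F_(n-j)], which determines them from [F_0] once
    one can divide by [n]. *)
Lemma tderiv_uniq P F G : fcoef P 0 = 0 -> fcoef F 0 = fcoef G 0 ->
  tderiv F = P * F -> tderiv G = P * G -> F = G.
Proof.
move=> P0 FG0 dF dG; apply: subr0_eq.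
have dh : tderiv (F - G) = P * (F - G) by rewrite tderivB dF dG mulrBr.
have h0 : fcoef (F - G) 0 = 0 by rewrite fcoefB FG0 subrr.
move: (F - G) dh h0 => h dh h0; apply: fpsP => n; rewrite fcoef0.
have [m] := ubnP n; elim: m n => // m IH [//|n]; rewrite ltnS => le_nm.
apply: (@fps_mulrn_eq0 n).
have /(congr1 (fun f => fcoef f n.+1)) := dh; rewrite [fcoef (tderiv h) _]/= => ->.
rewrite fcoefM big_ord_recl P0 mul0r add0r big1 // => j _.
by rewrite /= IH ?mulr0 // /bump /= add1n subSS (leq_ltn_trans (leq_subr _ _)).
Qed.

End LogDerivative.

Section CharSeries.
Variable R : comNzRingType.

Definition mxpow n (B : 'M[R]_n) l : 'M[R]_n := iter l (fun M => M *m B) 1%:M.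

Definition charseries n (B : 'M[R]_n) : 'M[fps R]_n := 1%:M - fpsX *: map_mx (@fpsC R) B.

Definition geomseries n (B : 'M[R]_n) : 'M[fps R]_n :=
  \matrix_(i, j) Fps (fun l => mxpow B l i j).

Definition trseries n (B : 'M[R]_n) : fps R :=
  Fps (fun l => if l is 0 then 0 else \tr (mxpow B l)).

Lemma geomseriesK n (B : 'M[R]_n) : geomseries B *m charseries B = 1%:M.
Proof.
rewrite /charseries mulmxBr mulmx1 -scalemxAr; apply/matrixP => i j; apply: fpsP => l.
rewrite !mxE fcoefB fcoefXM [fcoef (Fps _) _]/=.
case: l => [|l]; first by rewrite subr0 /= mxE; case: eqP.
rewrite fcoef_sum [mxpow B l.+1]/(mxpow B l *m B) mxE -sumrB big1 => [|a _]; first by case: eqP.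
by rewrite !mxE [X in fcoef X _]mulrC fcoefCM /= mulrC subrr.
Qed.

Lemma charseries_unit n (B : 'M[R]_n) : \det (charseries B) \is a GRing.unit.
Proof.
apply/unitrPr; exists (\det (geomseries B)).
by rewrite mulrC -det_mulmx geomseriesK det1.
Qed.

Lemma charseries0 n (B : 'M[R]_n) : fcoef (\det (charseries B)) 0 = 1.
Proof.
rewrite -/(const_coef _) -det_map_mx (_ : map_mx _ _ = 1%:M) ?det1 //.
apply/matrixP => i j; rewrite !mxE rmorphB rmorph_nat rmorphM [X in X * _](_ : _ = 0) //.
by rewrite mul0r subr0.
Qed.

(** The inverse of [1 - t B] is the geometric series [sum_l t^l B^l], so its
    adjugate is [det(1 - t B)] times that series; since [t d/dt (1 - t B)] equals
    [(1 - t B) - 1], Jacobi's formula leaves the trace of one minus the geometric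
    series. *)
Lemma tderiv_charseries n (B : 'M[R]_n) :
  tderiv (\det (charseries B)) = - trseries B * \det (charseries B).
Proof.
rewrite tderiv_det.
have adjE : \adj (charseries B) = \det (charseries B) *: geomseries B.
  by rewrite -[LHS]mul1mx -(geomseriesK B) -mulmxA mul_mx_adj mul_mx_scalar.
have -> : map_mx (@tderiv R) (charseries B) = charseries B - 1%:M.
  apply/matrixP => i j; rewrite !mxE tderivB.
  rewrite (_ : tderiv _ = 0) ?sub0r; last by case: eqP => _; rewrite ?tderiv0 ?tderiv1.
  rewrite addrAC subrr add0r; congr (- _); apply: fpsP => l.
  rewrite [LHS](_ : _ = fcoef (fpsX * fpsC (B i j)) l *+ l) // fcoefXM.
  by case: l => [|[|l]] //=; rewrite ?mul0rn.
rewrite adjE -scalemxAr linearZ /= mulrC; congr (_ * _).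
rewrite mxtrace_mulC mulmxBr geomseriesK mulmx1 linearB /= mxtrace1.
apply: fpsP => l; rewrite fcoefN fcoefB fcoefMn fcoef1 [fcoef (trseries _) _]/=.
rewrite /mxtrace fcoef_sum.
case: l => [|l] /=.
  rewrite (eq_bigr (fun=> 1)) => [|i _]; last by rewrite !mxE /= mxE eqxx.
  by rewrite sumr_const card_ord subrr oppr0.
by rewrite mul0rn sub0r; congr (- _); apply: eq_bigr => i _; rewrite mxE.
Qed.

Lemma charseries_opp n (B : 'M[R]_n) :
  map_mx (@subst_opp R) (charseries B) = 1%:M + fpsX *: map_mx (@fpsC R) B.
Proof.
have XE : subst_opp fpsX = - fpsX :> fps R.
  by apply: fpsP => -[|[|l]]; rewrite /= ?mulr0 ?oppr0 ?mulr1 ?expr1.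
have CE c : subst_opp (fpsC c) = fpsC c :> fps R.
  by apply: fpsP => -[|l]; rewrite /= ?mulr0 ?mul1r.
apply/matrixP => i j; rewrite !mxE rmorphB rmorph_nat rmorphM /= XE CE.
by rewrite mulNr opprK.
Qed.

End CharSeries.

(** * Signed sums over permutations *)

Section RestrictedSign.
Variables (B : Type) (par : B -> bool).

Definition oddset n (b : 'I_n -> B) : {set 'I_n} := [set i | par (b i)].

(** Parity of the restriction of [g] to the positions holding an odd letter; it is
    meaningful when [g] preserves this set of positions. *)
Definition restr_odd n (b : 'I_n -> B) (g : 'S_n) : bool :=
  odd_perm (restr_perm (oddset b) g).

Definition par_stable n (b : 'I_n -> B) (g : 'S_n) :=
  forall i, par (b (g i)) = par (b i).

Lemma par_stableN n (b : 'I_n -> B) g :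
  par_stable b g -> g \in ('N(oddset b | 'P))%g.
Proof.
by move=> st; rewrite !inE /=; apply/subsetP => i; rewrite !inE /= /aperm st.
Qed.

Lemma restr_oddM n (b : 'I_n -> B) g h : par_stable b g -> par_stable b h ->
  restr_odd b (g * h)%g = restr_odd b g (+) restr_odd b h.
Proof.
move=> /par_stableN sg /par_stableN sh.
by rewrite /restr_odd morphM // odd_permM.
Qed.

Lemma restr_odd1 n (b : 'I_n -> B) : restr_odd b 1%g = false.
Proof. by rewrite /restr_odd morph1 odd_perm1. Qed.

Lemma par_stable_tperm n (b : 'I_n -> B) i j : par (b i) = par (b j) ->
  par_stable b (tperm i j).
Proof. by move=> e k; case: tpermP => [->|->|]. Qed.

Lemma restr_odd_tperm n (b : 'I_n -> B) i j : i != j -> par (b i) = par (b j) ->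
  restr_odd b (tperm i j) = par (b i).
Proof.
move=> neq_ij eq_par; have st := par_stableN (par_stable_tperm eq_par).
have [pi|npi] := boolP (par (b i)).
  have -> : restr_odd b (tperm i j) = odd_perm (tperm i j).
    congr odd_perm; apply/permP => k; have [kD|kND] := boolP (k \in oddset b).
      by rewrite restr_permE.
    rewrite (out_perm (restr_perm_on _ _)) // tpermD //; apply: contraNneq kND.
      by move=> <-; rewrite inE.
    by move=> <-; rewrite inE -eq_par.
  by rewrite odd_tperm neq_ij.
rewrite /restr_odd (_ : restr_perm _ _ = 1%g) ?odd_perm1 //.
apply/permP => k; rewrite perm1; have [kD|kND] := boolP (k \in oddset b).
  rewrite restr_permE //; move: kD; rewrite inE.
  by case: tpermP => // ->; rewrite -?eq_par (negPf npi).
by rewrite (out_perm (restr_perm_on _ _)).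
Qed.

Lemma restr_odd_lift n (b : 'I_n.+1 -> B) p s :
  par_stable (b \o lift p) s ->
  restr_odd b (lift_perm p p s) = restr_odd (b \o lift p) s.
Proof.
move=> st; have stN := par_stableN st.
have st' : lift_perm p p s \in ('N(oddset b | 'P))%g.
  apply: par_stableN => i; case: (unliftP p i) => [j|] ->.
    by rewrite lift_perm_lift; apply: st.
  by rewrite lift_perm_id.
rewrite /restr_odd (_ : restr_perm _ _ = lift_perm p p (restr_perm (oddset (b \o lift p)) s)).
  by rewrite odd_lift_perm addbb.
apply/permP => i; have [iD|iND] := boolP (i \in oddset b).
  rewrite restr_permE //; move: iD; case: (unliftP p i) => [j|] -> iD.
    by rewrite !lift_perm_lift restr_permE //; move: iD; rewrite !inE.
  by rewrite !lift_perm_id.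
rewrite (out_perm (restr_perm_on _ _)) //.
move: iND; case: (unliftP p i) => [j|] -> iND.
  rewrite !lift_perm_lift (out_perm (restr_perm_on _ _)) //.
  by move: iND; rewrite !inE.
by rewrite !lift_perm_id.
Qed.

End RestrictedSign.

Section SignedSums.
Variables (R : comNzRingType) (B : finType) (par : B -> bool) (eta : bool).
Implicit Types M : B -> B -> R.

(** For equal matrices [N i] this is the product of the supertraces of [N^l] over
    the cycle lengths [l] of [g], since the signs attached to an odd cycle of
    length [l] amount to [(-1)^(l-1) (-1)^l = -1].  Distinct matrices are allowed so
    that positions can be deleted one at a time. *)
Definition cyc_term n (N : 'I_n -> B -> B -> R) (g : 'S_n) : R :=
  \sum_(b : {ffun 'I_n -> B}) (-1) ^+ restr_odd par b g *
    \prod_i ((-1) ^+ par (b i) * N i (b i) (b (g i))).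

Definition cyc_sum n (N : 'I_n -> B -> B -> R) : R :=
  \sum_(g : 'S_n) (-1) ^+ (eta && odd_perm g) * cyc_term N g.

Definition kernel_mul M M' : B -> B -> R := fun x z => \sum_y M x y * M' y z.
Definition strace M : R := \sum_x (-1) ^+ par x * M x x.
Definition par_homog M := forall x y, M x y != 0 -> par y = par x.

(** Every permutation [g] is obtained in exactly one way from a permutation of the
    positions other than [p], by inserting [p] either as a fixed point or just
    after another position [i] in its cycle. *)
Lemma sum_perm_lift n (p : 'I_n.+1) (G : 'S_n.+1 -> R) :
  \sum_g G g = \sum_i \sum_(s : 'S_n) G (tperm i p * lift_perm p p s)%g.
Proof.
rewrite pair_bigA /=.
pose h (q : 'I_n.+1 * 'S_n) := (tperm q.1 p * lift_perm p p q.2)%g.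
have inj_h : injective h.
  move=> [i s] [j s'] /= e.
  have eij : i = j.
    have /permP/(_ i) := e; rewrite /h /= !permM tpermL lift_perm_id.
    rewrite -[p in p = _](lift_perm_id p p s') => /perm_inj.
    by rewrite -[p in p = _](tpermL j p) => /perm_inj.
  rewrite -eij in e *; congr pair; move/mulgI: e => /permP e.
  by apply/permP => k; move/(_ (lift p k)): e; rewrite !lift_perm_lift => /lift_inj.
have bij_h : bijective h.
  apply: inj_card_bij => //; rewrite card_prod card_ord.
  by rewrite !card_Sn factS.
by rewrite (reindex h) //=; apply: onW_bij.
Qed.

Lemma sum_ffun_lift n (p : 'I_n.+1) (G : {ffun 'I_n.+1 -> B} -> R) :
  \sum_b G b = \sum_(b : {ffun 'I_n -> B}) \sum_(x : B)
     G [ffun k => oapp b x (unlift p k)].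
Proof.
rewrite pair_bigA /=.
rewrite (reindex (fun q : {ffun 'I_n -> B} * B =>
           [ffun k => oapp q.1 q.2 (unlift p k)])) //=; apply: onW_bij.
exists (fun b : {ffun 'I_n.+1 -> B} => ([ffun k => b (lift p k)], b p)).
  move=> [b x] /=; congr pair; last by rewrite ffunE unlift_none.
  by apply/ffunP => k; rewrite !ffunE liftK.
move=> b; apply/ffunP => k; rewrite !ffunE /=.
by case: (unliftP p k) => [j|] -> /=; rewrite ?ffunE.
Qed.

Lemma cyc_term_lift n (N : 'I_n.+1 -> B -> B -> R) p s :
  (forall i, par_homog (N i)) ->
  cyc_term N (lift_perm p p s) = strace (N p) * cyc_term (N \o lift p) s.
Proof.
move=> hN; rewrite /cyc_term (sum_ffun_lift p) mulr_sumr; apply: eq_bigr => b _.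
rewrite mulrC mulr_sumr; apply: eq_bigr => x _.
set b' := [ffun k => _].
have bp : b' p = x by rewrite ffunE unlift_none.
have bl k : b' (lift p k) = b k by rewrite ffunE liftK.
have blf : b' \o lift p = b by apply/funext => k /=.
rewrite (bigD1_ord p) //= lift_perm_id bp.
have -> : \prod_(i < n) ((-1) ^+ par (b' (lift p i)) *
      N (lift p i) (b' (lift p i)) (b' (lift_perm p p s (lift p i)))) =
    \prod_i ((-1) ^+ par (b i) * N (lift p i) (b i) (b (s i))).
  by apply: eq_bigr => i _; rewrite lift_perm_lift !bl.
set P := \prod_i _; have [->|nzP] := eqVneq P 0; first by rewrite !(mulr0, mul0r).
rewrite restr_odd_lift ?blf; first by rewrite mulrCA mulrC.
move=> i; apply: (hN (lift p i)); apply: contra_neq nzP => nz.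
by rewrite /P (bigD1 i) //= nz mulr0 mul0r.
Qed.

(** Deleting [p] from a cycle in which [i] precedes it contracts the letter at [p],
    that is, multiplies the matrix at [i] by the one at [p].  If the common parity
    of the letters involved is odd, deletion changes both the sign of the restricted
    permutation and the number of odd letters by one, so no sign is left. *)
Lemma cyc_term_tperm n (N : 'I_n.+1 -> B -> B -> R) p i s :
  (forall i, par_homog (N i)) ->
  cyc_term N (tperm (lift p i) p * lift_perm p p s)%g =
  cyc_term (fun k => if k == i then kernel_mul (N (lift p i)) (N p) else N (lift p k)) s.
Proof.
move=> hN; rewrite /cyc_term (sum_ffun_lift p); apply: eq_bigr => b _.
rewrite [in RHS](bigD1 i) //= eqxx /kernel_mul mulr_sumr mulr_suml mulr_sumr.
apply: eq_bigr => x _.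
set b' := [ffun k => _].
have bp : b' p = x by rewrite ffunE unlift_none.
have bl k : b' (lift p k) = b k by rewrite ffunE liftK.
have blf : b' \o lift p = b by apply/funext => k /=.
have nip : lift p i != p by rewrite eq_sym neq_lift.
rewrite (bigD1_ord p) //= !permM tpermR lift_perm_lift bp bl.
rewrite (bigD1 i) //= !permM tpermL lift_perm_id bp bl.
set P := \prod_(j < n | j != i) _; set Q := \prod_(j < n | j != i) _.
have <- : P = Q.
  apply: eq_bigr => k nki; rewrite (negPf nki) !permM tpermD ?lift_perm_lift ?bl //.
    by rewrite (inj_eq lift_inj) eq_sym.
  by rewrite neq_lift.
(* Away from zero terms, homogeneity forces the parities to agree along [s]. *)
have [->|nzP] := eqVneq P 0; first by rewrite !(mulr0, mul0r).
have [->|nzi] := eqVneq (N (lift p i) (b i) x) 0; first by rewrite !(mulr0, mul0r).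
have [->|nzp] := eqVneq (N p x (b (s i))) 0; first by rewrite !(mulr0, mul0r).
have parx := hN _ _ _ nzi; have pars := hN _ _ _ nzp.
have st : par_stable par b s.
  move=> k; have [->|nki] := eqVneq k i; first by rewrite pars.
  apply: (hN (lift p k)); apply: contra_neq nzP => nz.
  rewrite /P (bigD1 k) //= !permM tpermD ?lift_perm_lift ?bl ?nz ?mulr0 ?mul0r //.
    by rewrite (inj_eq lift_inj) eq_sym.
  by rewrite neq_lift.
rewrite restr_oddM; last first.
- move=> k; case: (unliftP p k) => [j|] ->; last by rewrite lift_perm_id.
  by rewrite lift_perm_lift !bl st.
- by apply: par_stable_tperm; rewrite bl bp parx.
rewrite restr_odd_tperm ?bl ?bp ?parx // restr_odd_lift ?blf // signr_addb.
set e : R := _ ^+ par _; set f := _ ^+ restr_odd _ _ _.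
have ee : e * e = 1 by rewrite -signr_addb addbb.
by ring: ee.
Qed.

Lemma cyc_sum_lift n (N : 'I_n.+1 -> B -> B -> R) p :
  (forall i, par_homog (N i)) ->
  cyc_sum N = strace (N p) * cyc_sum (N \o lift p) +
    (-1) ^+ eta * \sum_(i < n) cyc_sum
      (fun k => if k == i then kernel_mul (N (lift p i)) (N p) else N (lift p k)).
Proof.
move=> hN; rewrite /cyc_sum (sum_perm_lift p) (bigD1_ord p) //=; congr (_ + _).
  rewrite mulr_sumr; apply: eq_bigr => s _; rewrite tperm1 mul1g.
  by rewrite cyc_term_lift // odd_lift_perm addbb addFb mulrCA.
rewrite mulr_sumr; apply: eq_bigr => i _; rewrite mulr_sumr; apply: eq_bigr => s _.
rewrite cyc_term_tperm // mulrA; congr (_ * _).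
rewrite odd_permM odd_tperm odd_lift_perm addbb addFb.
rewrite [lift _ _ == _]eq_sym (negPf (neq_lift _ _)) /= -signr_addb.
by case: eta.
Qed.

(** [Mp l] plays the role of the [l]-th power of one fixed matrix [Mp 1]. *)
Variable Mp : nat -> B -> B -> R.
Hypothesis MpD : forall a b, kernel_mul (Mp a) (Mp b) = Mp (a + b).
Hypothesis Mp_homog : forall a, par_homog (Mp a).

Definition perm_sum n : R := cyc_sum (fun _ : 'I_n => Mp 1).

Lemma perm_sum0 : perm_sum 0 = 1.
Proof.
rewrite /perm_sum /cyc_sum (big_pred1 1%g); last first.
  by move=> s; apply/esym/eqP/permP => -[].
rewrite odd_perm1 andbF mul1r /cyc_term (eq_bigr (fun=> 1)) => [|b _].
  by rewrite sumr_const card_ffun card_ord expn0.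
by rewrite restr_odd1 big_ord0 mulr1.
Qed.

(** Induction on the number of positions: deleting the marked position [p] either
    closes its cycle, giving the supertrace of [Mp l.+1], or raises the power of the
    matrix at one of the [n] remaining positions, which becomes the marked one. *)
Lemma cyc_sum_marked n (p : 'I_n.+1) l :
  cyc_sum (fun i => if i == p then Mp l.+1 else Mp 1) =
  \sum_(j < n.+1) (-1) ^+ (eta * j)%N * (n ^_ j)%:R * strace (Mp (l + j).+1)
     * perm_sum (n - j).
Proof.
elim: n p l => [|n IHn] p l.
  rewrite (cyc_sum_lift p); last by move=> i; case: ifP.
  rewrite big_ord0 mulr0 addr0 big_ord1 eqxx /= muln0 addn0 !mul1r; congr (_ * _).
  by congr cyc_sum; apply/funext => -[].
rewrite (cyc_sum_lift p); last by move=> i; case: ifP.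
rewrite eqxx [in RHS]big_ord_recl /= muln0 ffactn0 addn0 subn0 !mul1r; congr (_ + _).
  congr (_ * _); congr cyc_sum; apply/funext => k /=.
  by rewrite [lift _ _ == _]eq_sym (negPf (neq_lift _ _)).
rewrite (eq_bigr (fun=> \sum_(j < n.+1) (-1) ^+ (eta * j)%N * (n ^_ j)%:R *
    strace (Mp (l.+1 + j).+1) * perm_sum (n - j))); last first.
  move=> i _; rewrite -(IHn i); congr cyc_sum; apply/funext => k.
  have nlp j : lift p j == p = false by rewrite eq_sym (negPf (neq_lift _ _)).
  by rewrite !nlp MpD add1n.
rewrite sumr_const card_ord -mulr_natl !mulr_sumr; apply: eq_bigr => j _ /=.
rewrite /bump /= add1n ffactnS subSS natrM mulnS exprD addSnnS.
by ring.
Qed.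

Lemma perm_sum_newton n : perm_sum n.+1 =
  \sum_(j < n.+1) (-1) ^+ (eta * j)%N * (n ^_ j)%:R * strace (Mp j.+1) * perm_sum (n - j).
Proof.
rewrite -(cyc_sum_marked ord0 0); congr cyc_sum; apply/funext => i.
by case: ifP.
Qed.

End SignedSums.

(** * Traces *)

Section Traces.
Variable k : fieldType.

Lemma ltrace_coord (V : vectType k) (f : 'End(V)) :
  ltrace f = \sum_i coord (vbasis {:V}) i (f (vbasis {:V})`_i).
Proof.
rewrite /ltrace /mxtrace; apply: eq_bigr => i _.
by rewrite !mxE /= passmx.vecof_delta.
Qed.

Lemma ltraceD (V : vectType k) (f g : 'End(V)) : ltrace (f + g) = ltrace f + ltrace g.
Proof.
rewrite !ltrace_coord -big_split; apply: eq_bigr => i _.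
by rewrite lfunE /= linearD.
Qed.

Lemma ltraceZ (V : vectType k) c (f : 'End(V)) : ltrace (c *: f) = c * ltrace f.
Proof.
rewrite !ltrace_coord mulr_sumr; apply: eq_bigr => i _.
by rewrite lfunE /= linearZ.
Qed.

Lemma ltrace_sum (V : vectType k) (I : finType) (P : pred I) (F : I -> 'End(V)) :
  ltrace (\sum_(i | P i) F i) = \sum_(i | P i) ltrace (F i).
Proof.
apply: (big_morph _ (@ltraceD V)).
by rewrite -(scale0r 0) ltraceZ mul0r.
Qed.

Lemma ltraceC (U V : vectType k) (f : 'Hom(U, V)) (g : 'Hom(V, U)) :
  ltrace (f \o g)%VF = ltrace (g \o f)%VF.
Proof.
rewrite /ltrace /end_mx.
rewrite (passmx.mxof_comp _ _ (vbasisP {:U})) (passmx.mxof_comp _ _ (vbasisP {:V})).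
exact: mxtrace_mulC.
Qed.

(** The vectors [e i] need not form a basis: a resolution of the identity
    [v = sum_i lam_i(v) e_i] is enough to compute traces. *)
Lemma ltrace_resolution (V : vectType k) (I : finType) (P : pred I) (e : I -> V)
    (lam : I -> 'Hom(V, k^o)) (f : 'End(V)) :
  (forall v, v = \sum_(i | P i) lam i v *: e i) ->
  ltrace f = \sum_(i | P i) lam i (f (e i)).
Proof.
move=> res; rewrite ltrace_coord.
under eq_bigr => j _ do rewrite [f _]res linear_sum /=.
rewrite exchange_big; apply: eq_bigr => i _ /=.
rewrite [in RHS](coord_vbasis (memvf (e i))) !linear_sum /=; apply: eq_bigr => j _.
by rewrite !linearZ /= mulrC.
Qed.

(** With [pi] a projection onto [U], the restriction of [psi] to [U] and [psi o pi]
    are the two composites of the same pair of maps between [U] and [V]. *)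
Lemma ltrace_restr (V : vectType k) (U : {vspace V}) (psi pi : 'End(V)) :
    (forall v, pi v \in U) -> {in U, pi =1 id} -> {in U, forall v, psi v \in U} ->
  ltrace (linfun (vsproj U) \o psi \o linfun (vsval : subvs_of U -> V))%VF =
  ltrace (psi \o pi)%VF.
Proof.
move=> piU pi_id psiU.
have -> : (psi \o pi = (psi \o linfun (vsval : subvs_of U -> V)) \o (linfun (vsproj U) \o pi))%VF.
  by apply/lfunP => v; rewrite !comp_lfunE !lfunE /= vsprojK.
rewrite [RHS]ltraceC; congr ltrace; apply/lfunP => v.
rewrite !comp_lfunE !lfunE /= pi_id //; apply: psiU; apply: subvsP.
Qed.

(** The mean of the operators [r g] is a projection onto the invariants.  These
    operators compose as a right action, like pullbacks along permutations of
    coordinates. *)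
Lemma ltrace_invariants (V : vectType k) (gT : finGroupType) (G : {group gT})
    (r : gT -> 'End(V)) (psi : 'End(V)) (U := (\bigcap_(g in G) fixedSpace (r g))%VS) :
    [pchar k] =i pred0 ->
    (forall g h, g \in G -> h \in G -> r (g * h)%g = (r h \o r g)%VF) ->
    (forall g, g \in G -> (r g \o psi)%VF = (psi \o r g)%VF) ->
  ltrace (linfun (vsproj U) \o psi \o linfun (vsval : subvs_of U -> V))%VF =
  #|G|%:R^-1 * \sum_(g in G) ltrace (r g \o psi)%VF.
Proof.
move=> chk rM comm; pose pi := #|G|%:R^-1 *: \sum_(g in G) r g.
have nzG : #|G|%:R != 0 :> k by rewrite ((pcharf0P k).1 chk) -lt0n cardG_gt0.
have inU v : reflect {in G, forall g, r g v = v} (v \in U).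
  rewrite memvE; apply: (iffP subv_bigcapP) => fixv g gG.
    by apply/fixedSpaceP; rewrite memvE fixv.
  by rewrite -memvE; apply/fixedSpaceP; apply: fixv.
have piU v : pi v \in U.
  apply/inU => g gG; rewrite /pi !lfunE /= !sum_lfunE linearZ linear_sum /=.
  congr (_ *: _); rewrite [RHS](reindex_inj (mulIg g)) /=.
  apply: eq_big => [h|h hG]; first by rewrite groupMr.
  by rewrite rM // comp_lfunE.
have pi_id : {in U, pi =1 id}.
  move=> v /inU fixv; rewrite /pi !lfunE /= sum_lfunE.
  rewrite (eq_bigr (fun=> v)) => [|g gG]; last exact: fixv.
  by rewrite sumr_const -scaler_nat scalerA mulVf // scale1r.
have psiU : {in U, forall v, psi v \in U}.
  move=> v /inU fixv; apply/inU => g gG.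
  by rewrite -comp_lfunE comm // comp_lfunE fixv.
rewrite (ltrace_restr piU pi_id psiU) ltraceC.
rewrite /pi -comp_lfunZl ltraceZ; congr (_ * _); rewrite -ltrace_sum.
congr ltrace; apply/lfunP => v; rewrite comp_lfunE !sum_lfunE.
by apply: eq_bigr => g _; rewrite comp_lfunE.
Qed.

End Traces.

(** * Powers of an object and the Kunneth formula *)

Definition mk_bilinear (k : fieldType) (U V W : vectType k) (b : U -> V -> W)
  (hb : bilinear_for *:%R *:%R b) : {bilinear U -> V -> W} :=
  HB.pack b (bilinear_isBilinear.Build k U V W *:%R *:%R b hb).

Section ProductMorphisms.
Variable C : fpCategory.

Lemma fprod_mor_ext (I : finType) (F : I -> C) (Z : C) (h h' : mor Z (Defs.fprod F)) :
  (forall i, cmp (fproj i) h = cmp (fproj i) h') -> h = h'.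
Proof.
move=> e; rewrite (ftuple_uniq e).
by apply/esym/ftuple_uniq => i.
Qed.

Variable X : C.

Definition pow_init n : mor (pow X n.+2) (pow X n.+1) :=
  ftuple (fun i => ppr X (widen_ord (leqnSn n.+1) i)).
Definition pow_last n : mor (pow X n.+2) X := ppr X ord_max.

(** [pow_split] and [pow_merge] identify [X^(n+2)] with [X^(n+1) x X], for which
    the Kunneth formula is stated. *)
Definition pow_split n : mor (pow X n.+2) (prod2 (pow X n.+1) X) :=
  ftuple (fun b : bool =>
    match b return mor (pow X n.+2) (if b then pow X n.+1 else X) with
    | true => pow_init n | false => pow_last n end).

Definition pow_merge n : mor (prod2 (pow X n.+1) X) (pow X n.+2) :=
  ftuple (fun i => if unlift ord_max i is Some j
                   then cmp (ppr X j) (pr1 _ _) else pr2 _ _).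

Lemma widen_lift_max n (i : 'I_n) : widen_ord (leqnSn n) i = lift ord_max i.
Proof. by apply: val_inj; rewrite /= /bump leqNgt ltn_ord. Qed.

Lemma ppr_init n i : cmp (ppr X i) (pow_init n) = ppr X (widen_ord (leqnSn n.+1) i).
Proof. exact: fproj_tuple. Qed.

Lemma init_merge n : cmp (pow_init n) (pow_merge n) = pr1 _ _.
Proof.
apply: fprod_mor_ext => i.
rewrite cmpA [cmp (fproj i) _]ppr_init fproj_tuple /= widen_lift_max.
by rewrite liftK.
Qed.

Lemma last_merge n : cmp (pow_last n) (pow_merge n) = pr2 _ _.
Proof. by rewrite fproj_tuple unlift_none. Qed.

Lemma pr1_split n : cmp (pr1 _ _) (pow_split n) = pow_init n.
Proof. exact: (fproj_tuple _ true). Qed.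

Lemma pr2_split n : cmp (pr2 _ _) (pow_split n) = pow_last n.
Proof. exact: (fproj_tuple _ false). Qed.

Lemma merge_split n : cmp (pow_merge n) (pow_split n) = Defs.idm _.
Proof.
apply: fprod_mor_ext => i; rewrite cmpA cmpm1 fproj_tuple.
case: (unliftP ord_max i) => [j|] -> /=; last exact: pr2_split.
by rewrite -cmpA pr1_split ppr_init widen_lift_max.
Qed.

Definition pow1_in : mor X (pow X 1) := ftuple (fun=> Defs.idm X).

Lemma ppr_pow1 : cmp (ppr X ord0) pow1_in = Defs.idm X.
Proof. exact: (fproj_tuple (F := fun _ : 'I_1 => X)). Qed.

Lemma pow1_ppr : cmp pow1_in (ppr X ord0) = Defs.idm _.
Proof.
apply: fprod_mor_ext => i; rewrite cmpA cmpm1 fproj_tuple cmp1m.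
by rewrite (ord1 i).
Qed.

Lemma ppr_pperm n (g : 'S_n) i : cmp (ppr X i) (pperm X g) = ppr X (g i).
Proof. exact: fproj_tuple. Qed.

Lemma pperm_mul n (g h : 'S_n) : pperm X (g * h)%g = cmp (pperm X g) (pperm X h).
Proof.
apply: fprod_mor_ext => i; rewrite [LHS]ppr_pperm cmpA.
by rewrite [cmp _ (pperm X g)]ppr_pperm ppr_pperm permM.
Qed.

End ProductMorphisms.

Section PowKunneth.
Variables (C : fpCategory) (k : fieldType) (H : cohFunctor C k) (cp : cupProduct H).
Hypothesis hkun : kunneth cp.
Variable X : C.

Lemma pull_comp (A B D : C) (g : mor B D) (f : mor A B) i x :
  pull H f i (pull H g i x) = pull H (cmp g f) i x.
Proof. by rewrite pull_cmp comp_lfunE. Qed.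

Definition ext_cup n i j (x : H (pow X n.+1) i) (y : H X j) : H (pow X n.+2) (i + j)%N :=
  cup cp _ i j (pull H (pow_init X n) i x) (pull H (pow_last X n) j y).

(** The two halves of the universal property of the tensor product, transported to
    powers of [X]: every bilinear map on [H(X^(n+1)) x H(X)] comes from a graded map
    on [H(X^(n+2))], and such a map vanishes if it does so on exterior cup
    products. *)
Lemma pow_kunneth_ext n (Z : grvec k) (b : grbilin (H (pow X n.+1)) (H X) Z) :
  exists f : grhom (H (pow X n.+2)) Z,
    forall i j x y, f (i + j)%N (ext_cup x y) = b i j x y.
Proof.
have [T [t [tens [h [_ hE]]]]] := hkun (pow X n.+1) X.
have [f [fE _]] := tens Z b.
exists (fun m => f m \o h m \o pull H (pow_merge X n) m)%VF => i j x y.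
rewrite !comp_lfunE /ext_cup cup_pull !pull_comp init_merge last_merge.
by rewrite hE fE.
Qed.

Lemma pow_kunneth_uniq n (Z : grvec k) (f : grhom (H (pow X n.+2)) Z) :
  (forall i j (x : H _ i) y, f (i + j)%N (@ext_cup n i j x y) = 0) ->
  forall m x, f m x = 0.
Proof.
move=> f0; have [T [t [tens [h [h_bij hE]]]]] := hkun (pow X n.+1) X.
pose f' : grhom T Z := fun m => (f m \o pull H (pow_split X n) m \o (h m)^-1)%VF.
have hK m : lker (h m) == 0%VS by apply/lker0P; apply: bij_inj.
have b0 i j : bilinear_for *:%R *:%R (fun (x : H (pow X n.+1) i) (y : H X j) => 0 : Z (i + j)%N).
  by split=> ? c ? ? /=; rewrite scaler0 addr0.
have [g [_ g_uniq]] := tens Z (fun i j => mk_bilinear (b0 i j)).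
have f'0 : f' = fun m => 0.
  rewrite -(g_uniq f') => [|i j x y]; first rewrite -(g_uniq (fun m => 0)) // => i j x y.
    by rewrite lfunE.
  rewrite -hE !comp_lfunE lker0_lfunK // cup_pull !pull_comp pr1_split pr2_split.
  exact: f0.
move=> m x.
have -> : x = pull H (pow_split X n) m (pull H (pow_merge X n) m x).
  by rewrite pull_comp merge_split pull_id lfunE.
set y := pull H (pow_merge X n) m x.
have : f' m (h m y) = 0 by rewrite f'0 lfunE.
by rewrite !comp_lfunE lker0_lfunK.
Qed.

End PowKunneth.

(** * The Koszul sign *)

Section KoszulSign.
Variables (C : fpCategory) (k : fieldType) (H : cohFunctor C k) (cp : cupProduct H).
Variable Y : C.
Notation hY := (homog (H Y)).
Implicit Types (a b : hY).

Definition hsign (s : bool) (a : hY) : hY := homog_scale ((-1) ^+ s) a.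

Lemma hsign0 a : hsign false a = a.
Proof. by case: a => i x; rewrite /hsign /homog_scale scale1r. Qed.

Lemma hsign_add s t a : hsign s (hsign t a) = hsign (s (+) t) a.
Proof. by rewrite /hsign /homog_scale /= scalerA signr_addb. Qed.

Lemma hcup_signl s a b : hcup cp (hsign s a) b = hsign s (hcup cp a b).
Proof. by rewrite /hcup /hcup_of /hsign /homog_scale /= linearZl_LR. Qed.

Lemma hcup_signr s a b : hcup cp a (hsign s b) = hsign s (hcup cp a b).
Proof. by rewrite /hcup /hcup_of /hsign /homog_scale /= linearZr_LR. Qed.

Lemma hcupC a b : hcup cp a b = hsign (odd (tag a) && odd (tag b)) (hcup cp b a).
Proof. by rewrite /hcup cupC /hsign -oddM signr_odd. Qed.

Lemma hcupA a b c : hcup cp a (hcup cp b c) = hcup cp (hcup cp a b) c.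
Proof. exact: cupA. Qed.

(** Indexing the factors by all of [nat] makes transpositions of neighbours easy
    to describe. *)
Fixpoint ncups (c : nat -> hY) n : hY :=
  if n is n'.+1 then hcup cp (ncups c n') (c n) else c 0.

Lemma eq_ncups c c' n : (forall i, (i <= n)%N -> c i = c' i) -> ncups c n = ncups c' n.
Proof.
elim: n => [|n IH] e /=; first exact: e.
by rewrite e // IH // => i le_in; apply: e; apply: leqW.
Qed.

Lemma cups_ncups n (c : 'I_n.+1 -> hY) : cups cp c = ncups (fun i => c (inord i)) n.
Proof.
elim: n c => [|n IH] c /=; first by congr c; apply: val_inj; rewrite /= inordK.
rewrite IH; congr hcup.
  apply: eq_ncups => i le_in; congr c; apply: val_inj => /=.
  by rewrite !inordK // ltnS ltnW.
by congr c; apply: val_inj => /=; rewrite inordK.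
Qed.

Definition nswap i j x : nat := if x == i then j else if x == j then i else x.

Lemma ncups_adjacent c n j : (j < n)%N ->
  ncups (c \o nswap j j.+1) n =
  hsign (odd (tag (c j)) && odd (tag (c j.+1))) (ncups c n).
Proof.
have ext j' m : (m < j')%N -> ncups (c \o nswap j' j'.+1) m = ncups c m.
  move=> lt_mj; apply: eq_ncups => i le_im /=; rewrite /nswap.
  have lt_ij := leq_ltn_trans le_im lt_mj.
  by rewrite !ltn_eqF // ltnW.
elim: n => [//|n IH]; rewrite ltnS leq_eqVlt => /orP[/eqP ->|lt_jn]; last first.
  rewrite /= IH // hcup_signl /nswap; congr (hsign _ (hcup _ _ _)).
  by rewrite !gtn_eqF // ltnS ltnW.
case: n {IH} => [|n] /=; rewrite /nswap !eqxx !(gtn_eqF (leqnn _)) /=.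
  by rewrite hcupC andbC.
rewrite -/(nswap _ _) ext // -[LHS]hcupA -[in RHS]hcupA -hcup_signr; congr hcup.
by rewrite hcupC andbC.
Qed.

(** Moving the [i]-th factor past those up to the [j]-th one and back yields signs
    depending on the degrees in between.  These cancel when the two exchanged
    factors have the same degree, leaving only the sign of their own exchange. *)
Lemma ncups_swap n i j (d : nat -> nat) : (i < j <= n)%N ->
  exists s : bool, (d i = d j -> s = odd (d i)) /\
    forall c, (forall x, tag (c x) = d x) ->
      ncups (c \o nswap i j) n = hsign s (ncups c n).
Proof.
case/andP=> lt_ij le_jn.
elim: j d lt_ij le_jn => [//|j IH] d; rewrite ltnS leq_eqVlt.
case/orP => [/eqP -> lt_jn | lt_ij lt_jn].
  exists (odd (d j) && odd (d j.+1)); split=> [->|c cd]; first by rewrite andbb.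
  by rewrite ncups_adjacent // !cd.
have [s [s_eq sP]] := IH (d \o nswap j j.+1) lt_ij (ltnW lt_jn).
have [ji ij] : (j == i = false) /\ (i == j = false) by split; [rewrite gtn_eqF | rewrite ltn_eqF].
have [jSi iSj] : (j.+1 == i = false) /\ (i == j.+1 = false).
  by split; [rewrite gtn_eqF | rewrite ltn_eqF] => //; apply: ltnW.
have [jjS jSj] : (j == j.+1 = false) /\ (j.+1 == j = false).
  by split; [rewrite ltn_eqF | rewrite gtn_eqF].
exists ((odd (d i) && odd (d j)) (+) s (+) (odd (d j) && odd (d j.+1))); split.
  move=> e; rewrite s_eq /= /nswap ?ij ?iSj ?eqxx //.
  by rewrite -e andbC; do 2 case: (odd _).
move=> c cd.
have -> : c \o nswap i j.+1 = ((c \o nswap j j.+1) \o nswap i j) \o nswap j j.+1.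
  apply/funext => x /=; congr c; rewrite /nswap.
  have swE := (ji, ij, jSi, iSj, jjS, jSj, eqxx).
  have [->|nxi] := eqVneq x i; first by rewrite !swE.
  have [->|nxjS] := eqVneq x j.+1; first by rewrite !swE.
  have [->|nxj] := eqVneq x j; first by rewrite !swE.
  by rewrite !(negPf nxi, negPf nxj, negPf nxjS).
rewrite ncups_adjacent //= sP => [|x]; last exact: cd.
rewrite ncups_adjacent // !hsign_add !cd /nswap ?eqxx ?ji ?jSi ?jSj ?ij ?iSj.
by rewrite eqxx.
Qed.

Lemma cups_tperm n (i j : 'I_n.+1) (d : 'I_n.+1 -> nat) : i != j ->
  exists s : bool, (d i = d j -> s = odd (d i)) /\
    forall c : 'I_n.+1 -> hY, (forall x, tag (c x) = d x) ->
      cups cp (c \o tperm i j) = hsign s (cups cp c).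
Proof.
wlog lt_ij : i j / (i < j)%N => [th nij|_].
  case: (ltngtP i j) (nij) => [lt_ij|lt_ji|/val_inj -> /eqP //] _; first exact: th.
  have [||s [s_eq sP]] := th j i; rewrite ?lt_ji 1?eq_sym //.
  by exists s; split=> [e|c cd]; [rewrite s_eq e | rewrite tpermC sP].
have [|s [s_eq sP]] := @ncups_swap n i j (fun x => d (inord x)).
  by rewrite lt_ij -ltnS ltn_ord.
exists s; split; first by move: s_eq; rewrite !inord_val.
move=> c cd; rewrite !cups_ncups -sP => [|x]; last exact: cd.
apply: eq_ncups => x le_xn /=; congr c; rewrite /nswap.
have eq_in (y : 'I_n.+1) : (inord x == y) = (x == y :> nat).
  by rewrite -val_eqE /= inordK.
case: tpermP => [/eqP|/eqP|/eqP + /eqP]; rewrite !eq_in.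
- by move=> ->; rewrite inord_val.
- by move=> e; rewrite (eqP e) gtn_eqF ?eqxx ?inord_val //.
- by move=> /negPf -> /negPf ->.
Qed.

(** The sign [s] is chosen before the factors, from their degrees alone, so it does
    not change when degree-preserving maps are applied to the factors. *)
Lemma cups_perm n (g : 'S_n.+1) (d : 'I_n.+1 -> nat) :
  exists s : bool, forall c : 'I_n.+1 -> hY, (forall x, tag (c x) = d x) ->
    cups cp (c \o g) = hsign s (cups cp c).
Proof.
have [ts -> ts_nid] := prod_tpermP g.
elim: ts ts_nid d => [|[i j] ts IH] /= ts_nid d.
  exists false => c cd; rewrite big_nil hsign0; congr cups.
  by apply/funext => x /=; rewrite perm1.
case/andP: ts_nid => nij /IH{}IH; rewrite big_cons /=.
have [s sP] := IH d; set h : 'S__ := (\prod_(t <- ts) _)%g in sP *.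
have [s' [_ sP']] := cups_tperm (d \o h) nij.
exists (s' (+) s) => c cd; rewrite -hsign_add -sP // -sP' => [|x]; last exact: cd.
by congr cups; apply/funext => x /=; rewrite permM.
Qed.

(** A permutation preserving degrees is a product of transpositions of factors of
    equal degree, each of which acts by [-1] or [1] according to the parity of that
    degree. *)
Lemma cups_perm_stable n (g : 'S_n.+1) (c : 'I_n.+1 -> hY) :
  (forall x, tag (c (g x)) = tag (c x)) ->
  cups cp (c \o g) = hsign (restr_odd (fun a => odd (tag a)) c g) (cups cp c).
Proof.
have [m] := ubnP #|[pred x | g x != x]|; elim: m g => // m IH g.
rewrite ltnS => le_gm g_st.
have [-> | [i ngi]] : g = 1%g \/ exists i, g i != i.
  have [e|/existsP[i ni]] := altP (@forallP _ (fun i => g i == i)).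
    by left; apply/permP => i; rewrite perm1; apply/eqP.
  by right; exists i.
- rewrite restr_odd1 hsign0; congr cups; apply/funext => x /=; by rewrite perm1.
(* Splitting off [tperm i j] makes [i] a fixed point without moving any point
   that was fixed. *)
pose j := (g^-1)%g i; have gj : g j = i by rewrite permKV.
have nij : i != j by apply: contraNneq ngi => e; rewrite {1}e gj.
pose g' := (tperm i j * g)%g.
have g_def : g = (tperm i j * g')%g by rewrite mulgA tperm2 mul1g.
have dij : tag (c i) = tag (c j) by rewrite -[in LHS]gj g_st.
have g'_st x : tag (c (g' x)) = tag (c x).
  by rewrite permM g_st; case: tpermP => [->|->|].
have lt_g'm : (#|[pred x | g' x != x]| < m)%N.
  apply: leq_trans le_gm; apply: proper_card; apply/properP; split.
    apply/fintype.subsetP => x; rewrite !inE permM; case: tpermP => [->|->|//].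
      by rewrite gj eqxx.
    by rewrite gj.
  by exists i; rewrite !inE // permM tpermL gj eqxx.
rewrite [in RHS]g_def restr_oddM; last 2 first.
- by apply: par_stable_tperm; rewrite dij.
- by move=> x; rewrite g'_st.
rewrite -hsign_add restr_odd_tperm //; last by rewrite dij.
rewrite -IH //; have [s [s_eq sP]] := cups_tperm (tag \o c) nij.
rewrite /= in s_eq; rewrite -(s_eq dij) -sP => [|x]; last exact: g'_st.
by rewrite [in LHS]g_def; congr cups; apply/funext => x /=; rewrite permM.
Qed.

End KoszulSign.

(** * Words of basis vectors *)

Definition lfun_of (k : fieldType) (U V : vectType k) (f : U -> V) (hf : linear f) :
    'Hom(U, V) :=
  linfun (HB.pack_for {linear U -> V} f (GRing.isLinear.Build k U V *:%R f hf)).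

Lemma lfun_ofE (k : fieldType) (U V : vectType k) (f : U -> V) (hf : linear f) x :
  lfun_of hf x = f x.
Proof. by rewrite lfunE. Qed.

Section Letters.
Variables (k : fieldType) (V : grvec k).

Definition hcomp m (a : homog V) : V m :=
  if tag a =P m is ReflectT e then ecast i (V i : Type) e (tagged a) else 0.

Lemma hcomp_id m (x : V m) : hcomp m (hom_el x) = x.
Proof. by rewrite /hcomp /=; case: eqP => // e; rewrite eq_axiomK. Qed.

Lemma hcomp_tagged a : hcomp (tag a) a = tagged a.
Proof. by case: a => i x; apply: hcomp_id. Qed.

Lemma hcomp_out m (a : homog V) : tag a != m -> hcomp m a = 0.
Proof. by rewrite /hcomp; case: eqP. Qed.

Lemma hcomp_linear m i : linear (fun x : V i => hcomp m (hom_el x)).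
Proof.
move=> c x y; have [<-|ne] := eqVneq i m; first by rewrite !hcomp_id.
by rewrite !hcomp_out // scaler0 addr0.
Qed.

Definition letter := {i : nat & 'I_(\dim {: V i})}.
Definition letter_el (x : letter) : homog V := hom_el (vbasis {: V (tag x)})`_(tagged x).
Definition lcoord (x : letter) (a : homog V) : k :=
  coord (vbasis {: V (tag x)}) (tagged x) (hcomp (tag x) a).

Lemma lcoord_linear x i : linear (fun a : V i => lcoord x (hom_el a) : k^o).
Proof. by move=> c a b; rewrite /lcoord hcomp_linear linearP. Qed.

Lemma lcoord_out x a : tag a != tag x -> lcoord x a = 0.
Proof. by move=> ne; rewrite /lcoord hcomp_out // linear0. Qed.

Lemma lcoord_id i (a : 'I_(\dim {: V i})) (v : V i) :
  lcoord (existT _ i a) (hom_el v) = coord (vbasis {: V i}) a v.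
Proof. by rewrite /lcoord hcomp_id. Qed.

Lemma lcoord_el x y : lcoord x (letter_el y) = (x == y)%:R.
Proof.
case: x y => [i a] [j b]; have [e|ne] := eqVneq i j; last first.
  by rewrite lcoord_out ?[j == _]eq_sym // -tag_eqE /tag_eq /= (negPf ne).
case: j / e b => b; rewrite lcoord_id coord_free ?(basis_free (vbasisP _)) //.
by rewrite eq_Tagged /= eq_sym.
Qed.

(** Letters of degree at most [N] form a finite alphabet. *)
Definition bletter N := {i : 'I_N.+1 & 'I_(\dim {: V i})}.
Definition unbound N (x : bletter N) : letter := Tagged (fun i => 'I_(\dim {: V i})) (tagged x).

Lemma unbound_inj N : injective (@unbound N).
Proof.
move=> [i a] [j b] e.
have eij : i = j by apply: val_inj; exact: (congr1 tag e).
by case: j / eij b e => b /eqP; rewrite eq_Tagged => /eqP /= ->.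
Qed.

Lemma bound_letter N (x : letter) : (tag x <= N)%N -> exists y : bletter N, unbound y = x.
Proof.
case: x => i a /= le_iN.
by exists (existT (fun j : 'I_N.+1 => 'I_(\dim {: V j})) (Ordinal (le_iN : i < N.+1)%N) a).
Qed.

Lemma sum_bletter (R : nmodType) N (F : letter -> R) :
  \sum_(x : bletter N) F (unbound x) =
  \sum_(i < N.+1) \sum_(a < \dim {: V i}) F (existT _ (i : nat) a).
Proof. by rewrite sig_big_dep. Qed.

Lemma hom_basis_eq0 i (Z : vectType k) (f : 'Hom(V i, Z)) :
  (forall a : 'I_(\dim {: V i}), f (vbasis {: V i})`_a = 0) -> forall x, f x = 0.
Proof.
move=> f0 x; rewrite (coord_vbasis (memvf x)) linear_sum big1 // => a _.
by rewrite linearZ /= f0 scaler0.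
Qed.

End Letters.

Section Words.
Variables (C : fpCategory) (k : fieldType) (H : cohFunctor C k) (cp : cupProduct H).
Hypothesis hkun : kunneth cp.
Variable X : C.
Notation W n := (H (pow X n.+1)).

Lemma hpull_hcup (Y Z : C) (f : mor Y Z) (a b : homog (H Z)) :
  hpull f (hcup cp a b) = hcup cp (hpull f a) (hpull f b).
Proof. by rewrite /hpull /homog_map /hcup /hcup_of /= cup_pull. Qed.

Lemma hpull_comp (A B D : C) (g : mor B D) (f : mor A B) (a : homog (H D)) :
  hpull f (hpull g a) = hpull (cmp g f) a.
Proof. by rewrite /hpull /homog_map /= pull_comp. Qed.

Lemma hpull_cups (Y Z : C) (f : mor Y Z) n (c : 'I_n.+1 -> homog (H Z)) :
  hpull f (cups cp c) = cups cp (fun i => hpull f (c i)).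
Proof. by elim: n c => [//|n IH] c /=; rewrite hpull_hcup IH. Qed.

Lemma tag_cups (Y : C) n (c : 'I_n.+1 -> homog (H Y)) :
  tag (cups cp c) = (\sum_i tag (c i))%N.
Proof.
elim: n c => [|n IH] c; first by rewrite big_ord1.
by rewrite big_ord_recr /= IH.
Qed.

Definition pcup n (a : 'I_n.+1 -> homog (H X)) : homog (W n) :=
  cups cp (fun i => hpull (ppr X i) (a i)).

Definition hext_cup n (A : homog (W n)) (B : homog (H X)) : homog (W n.+1) :=
  hom_el (ext_cup cp (tagged A) (tagged B)).

Lemma pcupS n (a : 'I_n.+2 -> homog (H X)) :
  pcup a = hext_cup (pcup (fun i => a (widen_ord (leqnSn _) i))) (a ord_max).
Proof.
have -> A B : @hext_cup n A B = hcup cp (hpull (pow_init X n) A) (hpull (pow_last X n) B).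
  by [].
rewrite /pcup hpull_cups /=; congr hcup; congr cups.
by apply/funext => i; rewrite hpull_comp ppr_init.
Qed.

Lemma tag_pcup n (a : 'I_n.+1 -> homog (H X)) : tag (pcup a) = (\sum_i tag (a i))%N.
Proof. by rewrite tag_cups. Qed.

Lemma induces_exists (phi : grhom (H X) (H X)) n : exists Phi, @induces _ _ _ cp X phi n Phi.
Proof.
elim: n => [|n [Phi IH]].
  exists (fun m => pull H (ppr X ord0) m \o phi m \o pull H (pow1_in X) m)%VF => a /=.
  rewrite /hpull /homog_map /= !comp_lfunE pull_comp ppr_pow1 pull_id lfunE.
  by [].
have bil i j : bilinear_for *:%R *:%R
    (fun (x : W n i) (y : H X j) => ext_cup cp (Phi i x) (phi j y)).
  by split=> ? c ? ? /=; rewrite /ext_cup !linearP ?linearPl ?linearPr.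
have [f fE] := pow_kunneth_ext hkun (fun i j => mk_bilinear (bil i j)).
exists f => a; rewrite -!/(pcup _) !pcupS.
have -> A B : homog_map f (@hext_cup n A B) = hext_cup (homog_map Phi A) (homog_map phi B).
  by rewrite /homog_map /hext_cup /= fE.
by congr hext_cup; apply: IH.
Qed.

(** Induction on the length: the product of a linear form on [H(X^(n+1))] and a
    coordinate on [H(X)] is a bilinear map, to which the Kunneth formula applies. *)
Lemma word_coord_exists n (w : 'I_n.+1 -> letter (H X)) :
  exists lam : grhom (W n) (fun=> k^o), forall a : 'I_n.+1 -> homog (H X),
    lam _ (tagged (pcup a)) = \prod_i lcoord (w i) (a i).
Proof.
elim: n w => [|n IH] w.
  exists (fun m => lfun_of (@lcoord_linear _ _ (w ord0) m) \o pull H (pow1_in X) m)%VF => a.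
  rewrite big_ord1 comp_lfunE lfun_ofE /= pull_comp ppr_pow1 pull_id lfunE /=.
  by case: (a ord0).
have [lam lamE] := IH (fun i => w (widen_ord (leqnSn _) i)).
have bil i j : bilinear_for *:%R *:%R
    (fun (x : W n i) (y : H X j) => lam i x * lcoord (w ord_max) (hom_el y) : k^o).
  split=> [y|x] c ? ? /=; first by rewrite linearP mulrDl -scalerAl.
  by rewrite lcoord_linear mulrDr -scalerAr.
have [f fE] := pow_kunneth_ext hkun (Z := fun=> k^o) (fun i j => mk_bilinear (bil i j)).
exists f => a; rewrite pcupS /hext_cup /= fE /= lamE [RHS]big_ord_recr /=.
by case: (a ord_max).
Qed.

(** The target is graded so that the induction can use, for a fixed last letter of
    degree [j], the map into the shifted target [fun l => Z (l + j)]. *)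
Lemma word_uniq n (Z : grvec k) (f : grhom (W n) Z) :
  (forall w : 'I_n.+1 -> letter (H X), f _ (tagged (pcup (fun i => letter_el (w i)))) = 0) ->
  forall m x, f m x = 0.
Proof.
elim: n Z f => [|n IH] Z f f0.
  move=> m x; have -> : x = pull H (ppr X ord0) m (pull H (pow1_in X) m x).
    by rewrite pull_comp pow1_ppr pull_id lfunE.
  rewrite -comp_lfunE; apply: hom_basis_eq0 => a; rewrite comp_lfunE.
  exact: (f0 (fun=> existT _ m a)).
apply: pow_kunneth_uniq => // i j x.
have lin_r l y : linear (fun x : W n l => ext_cup cp x y : W n.+1 (l + j)%N).
  by move=> c ? ?; rewrite /ext_cup !linearP linearPl.
have lin_l : linear (fun y : H X j => ext_cup cp x y : W n.+1 (i + j)%N).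
  by move=> c ? ?; rewrite /ext_cup !linearP.
suff fx0 y : (f (i + j)%N \o lfun_of lin_l)%VF y = 0.
  by move=> y; have := fx0 y; rewrite comp_lfunE lfun_ofE.
move: y; apply: hom_basis_eq0 => b; rewrite comp_lfunE lfun_ofE.
set y := (vbasis _)`_b.
pose fy : grhom (W n) (fun l => Z (l + j)%N) :=
  fun l => (f (l + j)%N \o lfun_of (lin_r l y))%VF.
have fyE l z : fy l z = f (l + j)%N (ext_cup cp z y) by rewrite comp_lfunE lfun_ofE.
rewrite -fyE; apply: IH => w; rewrite fyE.
pose w' (i0 : 'I_n.+2) := oapp w (existT _ j b) (unlift ord_max i0).
have w'E : (fun i0 => letter_el (w' (widen_ord (leqnSn _) i0))) = fun i0 => letter_el (w i0).
  by apply/funext => i0; rewrite /w' widen_lift_max liftK.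
have := f0 w'; rewrite pcupS w'E.
by rewrite (_ : w' ord_max = existT _ j b) // /w' unlift_none.
Qed.

Definition word_coord n (w : 'I_n.+1 -> letter (H X)) : grhom (W n) (fun=> k^o) :=
  projT1 (cid (word_coord_exists w)).

Lemma word_coordE n (w : 'I_n.+1 -> letter (H X)) a :
  word_coord w _ (tagged (pcup a)) = \prod_i lcoord (w i) (a i).
Proof. by rewrite /word_coord; case: cid. Qed.

Definition word_el N n (w : {ffun 'I_n.+1 -> bletter (H X) N}) : homog (W n) :=
  pcup (fun i => letter_el (unbound (w i))).

(** The difference of the two sides is a graded map that vanishes on words, because
    [word_coord w] takes the value [1] on the word [w] and [0] on all others.  A
    word of total degree at most [N] has all its letters in the truncated
    alphabet. *)
Lemma word_resolution N n m (v : W n m) : (m <= N)%N ->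
  v = \sum_(w : {ffun 'I_n.+1 -> bletter (H X) N})
        word_coord (fun i => unbound (w i)) _ v *: hcomp m (word_el w).
Proof.
move=> le_mN.
have lin l : linear (fun v : W n l => \sum_(w : {ffun 'I_n.+1 -> bletter (H X) N})
        word_coord (fun i => unbound (w i)) _ v *: hcomp l (word_el w)).
  move=> c x y; rewrite scaler_sumr -big_split; apply: eq_bigr => w _ /=.
  by rewrite linearP scalerDl scalerA.
pose f : grhom (W n) (W n) := fun l => if (l <= N)%N then (\1 - lfun_of (lin l))%VF else 0.
suff : f m v = 0.
  by rewrite /f le_mN add_lfunE opp_lfunE id_lfunE lfun_ofE => e; apply: subr0_eq e.
move: m v {le_mN}; apply: word_uniq => w; rewrite /f; case: ifP; last by rewrite lfunE.
move=> le_degN; have le_wN := le_degN; rewrite tag_pcup in le_wN.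
have /choice[w0 w0E] i : exists y : bletter (H X) N, unbound y = w i.
  apply: bound_letter; apply: leq_trans le_wN.
  by rewrite (bigD1 i) //= leq_addr.
rewrite add_lfunE opp_lfunE id_lfunE lfun_ofE (bigD1 (finfun w0)) //= big1 => [|w1 nw1].
  rewrite word_coordE big1 => [|i _]; last first.
    by rewrite ffunE w0E lcoord_el eqxx.
  rewrite scale1r addr0 [X in _ - X](_ : _ = tagged (pcup (fun i => letter_el (w i)))) ?subrr //.
  rewrite -[RHS]hcomp_tagged; congr hcomp; congr pcup; apply/funext => i.
  by rewrite ffunE w0E.
rewrite word_coordE; have [i nwi] : exists i, unbound (w1 i) != w i.
  apply/existsP; apply: contraR nw1; rewrite negb_exists => /forallP e.
  apply/eqP/ffunP => i; rewrite ffunE; apply: unbound_inj; rewrite w0E.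
  by apply/eqP; rewrite -[_ == _]negbK.
by rewrite (bigD1 i) //= lcoord_el (negPf nwi) mul0r scale0r.
Qed.

End Words.

(** * Traces of permutations on the cohomology of powers *)

Section LetterMatrices.
Variables (k : fieldType) (V : grvec k) (phi : grhom V V) (N : nat).

Definition lpow (U : vectType k) (f : 'End(U)) l : 'End(U) := iter l (comp_lfun f) \1%VF.

Lemma iter_homog_map l i (v : V i) :
  iter l (homog_map phi) (hom_el v) = hom_el (lpow (phi i) l v).
Proof.
elim: l => [|l IH] /=; first by rewrite id_lfunE.
by rewrite IH /homog_map /= comp_lfunE.
Qed.

Lemma tag_iter_homog_map l (a : homog V) : tag (iter l (homog_map phi) a) = tag a.
Proof. by elim: l => //= l ->. Qed.

Definition bdeg (x : bletter V N) : nat := tag (unbound x).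
Definition bpar (x : bletter V N) : bool := odd (bdeg x).

Definition lcoef l (x y : bletter V N) : k :=
  lcoord (unbound y) (iter l (homog_map phi) (letter_el (unbound x))).

(** The matrix of the [l]-th power of [phi] on the truncated alphabet, with degrees
    recorded by powers of [u]; weighting by [l] times the degree makes these
    matrices multiplicative in [l]. *)
Definition lmatrix l (x y : bletter V N) : fps k :=
  fpsX ^+ (l * bdeg x)%N * fpsC (lcoef l x y).

Lemma lcoef_out l x y : bdeg x != bdeg y -> lcoef l x y = 0.
Proof. by move=> ne; rewrite /lcoef lcoord_out ?tag_iter_homog_map. Qed.

Lemma lmatrix_homog l : par_homog bpar (lmatrix l).
Proof.
move=> x y; rewrite /bpar; have [->//|ne] := eqVneq (bdeg x) (bdeg y).
by rewrite /lmatrix lcoef_out // rmorph0 mulr0 eqxx.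
Qed.

Lemma lcoord_expand l z (a : homog V) : (tag a <= N)%N ->
  \sum_(y : bletter V N) lcoord (unbound y) a *
     lcoord z (iter l (homog_map phi) (letter_el (unbound y))) =
  lcoord z (iter l (homog_map phi) a).
Proof.
case: a => i v /= le_iN.
rewrite (sum_bletter N (fun y => lcoord y _ * lcoord z (iter l (homog_map phi) (letter_el y)))).
rewrite (bigD1 (Ordinal (le_iN : i < N.+1)%N)) //= [X in _ + X]big1 ?addr0 => [|j nj].
  rewrite -[existT _ i v]/(hom_el v) iter_homog_map [in RHS](coord_vbasis (memvf v)).
  rewrite linear_sum /= -(lfun_ofE (@lcoord_linear _ _ z i)) linear_sum /=.
  apply: eq_bigr => a _; rewrite !linearZ /= lfun_ofE -iter_homog_map.
  by rewrite lcoord_id.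
apply: big1 => a _; rewrite lcoord_out ?mul0r //=.
by apply: contraNneq nj => e; apply/eqP/val_inj.
Qed.

Lemma lmatrixM a b : kernel_mul (lmatrix a) (lmatrix b) = lmatrix (a + b).
Proof.
apply/funext => x; apply/funext => z; rewrite /kernel_mul /lmatrix.
rewrite (eq_bigr (fun y => fpsX ^+ ((a + b) * bdeg x)%N * fpsC (lcoef a x y * lcoef b y z))).
  rewrite -mulr_sumr -rmorph_sum; congr (_ * fpsC _).
  rewrite /lcoef addnC iterD lcoord_expand // tag_iter_homog_map.
  by rewrite -ltnS; apply: ltn_ord.
move=> y _; rewrite mulnDl exprD rmorphM.
have [->|ne] := eqVneq (bdeg x) (bdeg y); first by rewrite mulrACA.
by rewrite lcoef_out // !rmorph0 !(mul0r, mulr0).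
Qed.

End LetterMatrices.

Section PowerSums.
Variables (k : fieldType) (V : grvec k) (phi : grhom V V).

(** The super power sum [sum_i (-1)^i tr(phi_i^l) u^(i l)]. *)
Definition psum l : fps k :=
  Fps (fun m => \sum_(i < m.+1 | (l * i)%N == m) (-1) ^+ i * ltrace (lpow (phi i) l)).

Lemma strace_lmatrix N l m : (m <= N)%N ->
  fcoef (strace (@bpar k V N) (lmatrix phi l.+1)) m = fcoef (psum l.+1) m.
Proof.
move=> le_mN; rewrite /strace.
rewrite (sum_bletter N (fun x => (-1) ^+ odd (tag x) * (fpsX ^+ (l.+1 * tag x)%N *
  fpsC (lcoord x (iter l.+1 (homog_map phi) (letter_el x)))))).
rewrite fcoef_sum [RHS]/= (big_ord_widen_cond N.+1 (fun i => (l.+1 * i)%N == m)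
  (fun i => (-1) ^+ i * ltrace (lpow (phi i) l.+1))) //.
rewrite [RHS]big_mkcond; apply: eq_bigr => i _ /=.
rewrite -!mulr_sumr -rmorph_sum signr_odd fcoef_signM fcoefXnC.
have [<-|_] := eqVneq (l.+1 * i)%N m; last by rewrite mulr0.
rewrite ltnS leq_pmull //; congr (_ * _).
rewrite ltrace_coord; apply: eq_bigr => a _.
rewrite -[letter_el _]/(hom_el (vbasis {: V i})`_a) -iterS iter_homog_map.
by rewrite lcoord_id.
Qed.

End PowerSums.

Section PermutationTraces.
Variables (C : fpCategory) (k : fieldType) (H : cohFunctor C k) (cp : cupProduct H).
Hypothesis hkun : kunneth cp.
Variables (X : C) (phi : grhom (H X) (H X)).
Notation W n := (H (pow X n.+1)).

Lemma ltrace_word N n m (f : 'End(W n m)) : (m <= N)%N ->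
  ltrace f = \sum_(w : {ffun 'I_n.+1 -> bletter (H X) N})
    word_coord hkun (fun i => unbound (w i)) _ (f (hcomp m (word_el cp w))).
Proof.
move=> le_mN; apply: (ltrace_resolution (P := predT)) => v.
exact: word_resolution.
Qed.

Lemma hpull_pperm n (g : 'S_n.+1) (a : 'I_n.+1 -> homog (H X)) :
  hpull (pperm X g) (pcup cp a) =
  cups cp ((fun j => hpull (ppr X j) (a (g^-1 j)%g)) \o g).
Proof.
rewrite hpull_cups; congr cups; apply/funext => i /=.
by rewrite hpull_comp ppr_pperm permK.
Qed.

Variables (n : nat) (Phi : grhom (W n) (W n)).
Hypothesis PhiP : induces cp phi Phi.

(** Both composites reorder the factors of a word, and applying [phi] to the factors
    keeps their degrees, hence the sign of the reordering. *)
Lemma induces_pperm (g : 'S_n.+1) m :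
  (pull H (pperm X g) m \o Phi m)%VF = (Phi m \o pull H (pperm X g) m)%VF.
Proof.
apply/lfunP => x; apply: subr0_eq.
pose D : grhom (W n) (W n) := fun m =>
  (pull H (pperm X g) m \o Phi m)%VF - (Phi m \o pull H (pperm X g) m)%VF.
transitivity (D m x); first by rewrite [RHS]add_lfunE opp_lfunE.
move: m x; apply: (word_uniq hkun (cp := cp)) => w.
set a := fun i => letter_el (w i).
rewrite [LHS]add_lfunE opp_lfunE !comp_lfunE.
have [s sP] := cups_perm cp (pow X n.+1) g (fun j => tag (a (g^-1 j)%g)).
have e1 : hpull (pperm X g) (homog_map Phi (pcup cp a)) =
    hsign s (pcup cp (fun j => homog_map phi (a (g^-1 j)%g))).
  by rewrite PhiP hpull_pperm sP.
have e2 : homog_map Phi (hpull (pperm X g) (pcup cp a)) =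
    hsign s (pcup cp (fun j => homog_map phi (a (g^-1 j)%g))).
  rewrite hpull_pperm sP // /pcup -PhiP.
  by rewrite /hsign /homog_map /homog_scale /= linearZ.
have := etrans e1 (esym e2); rewrite /hpull /homog_map /= => /eqP.
by rewrite eq_Tagged => /eqP /= ->; rewrite subrr.
Qed.

Lemma word_coord_perm N (g : 'S_n.+1) (b : {ffun 'I_n.+1 -> bletter (H X) N}) :
  word_coord hkun (fun i => unbound (b i)) _
    (tagged (hpull (pperm X g) (homog_map Phi (word_el cp b)))) =
  (-1) ^+ restr_odd (@bpar k (H X) N) b g * \prod_i lcoef phi 1 (b i) (b (g i)).
Proof.
set c := fun j => homog_map phi (letter_el (unbound (b (g^-1 j)%g))).
have prodE : \prod_j lcoord (unbound (b j)) (c j) = \prod_i lcoef phi 1 (b i) (b (g i)).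
  rewrite (reindex_inj (@perm_inj _ g)); apply: eq_bigr => i _.
  by rewrite /c permK.
have signE s : hpull (pperm X g) (homog_map Phi (word_el cp b)) = hsign s (pcup cp c) ->
    word_coord hkun (fun i => unbound (b i)) _
      (tagged (hpull (pperm X g) (homog_map Phi (word_el cp b)))) =
    (-1) ^+ s * \prod_i lcoef phi 1 (b i) (b (g i)).
  by move=> ->; rewrite linearZ /= word_coordE prodE.
rewrite /word_el PhiP hpull_pperm in signE *.
have [st|/existsNP[i nst]] := pselect (forall i, bdeg (b (g i)) = bdeg (b i)).
  have degc j : tag (c j) = bdeg (b j) by rewrite -[in RHS](permKV g j) st.
  rewrite (signE (restr_odd (@bpar k (H X) N) b g)) //.
  rewrite cups_perm_stable => [|j]; last exact: etrans (degc _) (etrans (st j) (esym (degc j))).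
  congr (hsign (odd_perm (restr_perm _ _)) _).
  by apply/setP => j; rewrite !inE; congr odd; apply: degc.
have [s sP] := cups_perm cp (pow X n.+1) g (fun j => tag (c j)).
rewrite (signE s) ?sP // (bigD1 i) //= lcoef_out ?mul0r ?mulr0 //.
by apply/eqP => e; apply: nst.
Qed.

Lemma lefschetz_perm N (g : 'S_n.+1) m : (m <= N)%N ->
  fcoef (lefschetz (fun m => pull H (pperm X g) m \o Phi m)%VF) m =
  fcoef (cyc_term (@bpar k (H X) N) (fun=> lmatrix phi 1) g) m.
Proof.
move=> le_mN; rewrite [LHS]/= (ltrace_word _ le_mN) mulr_sumr fcoef_sum.
apply: eq_bigr => b _.
pose d := (\sum_i bdeg (b i))%N.
have prodE : \prod_i ((-1) ^+ bpar (b i) * lmatrix phi 1 (b i) (b (g i))) =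
    (-1) ^+ d * (fpsX ^+ d * fpsC (\prod_i lcoef phi 1 (b i) (b (g i)))).
  rewrite /d !expr_sum rmorph_prod -!big_split; apply: eq_bigr => i _ /=.
  by rewrite /bpar signr_odd /lmatrix mul1n.
rewrite prodE !fcoef_signM fcoefXnC.
have degE : tag (word_el cp b) = d by rewrite tag_pcup.
have [e|ne] := eqVneq d m; last first.
  by rewrite hcomp_out ?degE // !linear0 !mulr0.
rewrite -e -degE hcomp_tagged comp_lfunE.
have := word_coord_perm g b; rewrite /= => ->.
by rewrite mulrCA.
Qed.

End PermutationTraces.

(** * Generating series *)

Section Assembly.
Variables (C : fpCategory) (k : fieldType).
Hypothesis hk : [pchar k] =i pred0.
Variables (H : cohFunctor C k) (cp : cupProduct H).
Hypothesis hkun : kunneth cp.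
Variables (X : C) (phi : grhom (H X) (H X)).

Lemma induced_induces n : induces cp phi (induced cp phi n).
Proof.
exact: (@classical_sets.xgetPex _ _ (fun Phi => induces cp phi Phi)
  (induces_exists hkun phi n)).
Qed.

Definition perm_lefschetz n (g : 'S_n.+1) : fps k :=
  lefschetz (fun m => pull H (pperm X g) m \o induced cp phi n m)%VF.

Lemma lefschetz_invariants n (G : {group 'S_n.+1}) :
  lefschetz (restr (induced cp phi n) (invariants H X G)) =
  fpsC #|G|%:R^-1 * \sum_(g in G) perm_lefschetz g.
Proof.
apply: fpsP => m; rewrite fcoefCM fcoef_sum [LHS]/=.
rewrite -mulr_sumr mulrCA; congr (_ * _).
apply: (ltrace_invariants (r := fun g => pull H (pperm X g) m)) => //.
  by move=> g h _ _; rewrite pperm_mul pull_cmp.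
by move=> g _; apply: (induces_pperm hkun); apply: induced_induces.
Qed.

Definition twisted_sum (eta : bool) n : fps k :=
  if n is n'.+1
  then \sum_(g : 'S_n'.+1) (-1) ^+ (eta && odd_perm g) * perm_lefschetz g
  else 1.

(** A word of total degree [m] only has letters of degree at most [m], so its
    contribution is already seen in the alphabet truncated at [N]. *)
Lemma twisted_sum_trunc N eta n m : (m <= N)%N ->
  fcoef (twisted_sum eta n) m =
  fcoef (perm_sum (@bpar k (H X) N) eta (lmatrix phi (N := N)) n) m.
Proof.
case: n => [|n] le_mN; first by rewrite perm_sum0.
rewrite !fcoef_sum; apply: eq_bigr => g _; rewrite !fcoef_signM; congr (_ * _).
by apply: (lefschetz_perm hkun) => //; apply: induced_induces.
Qed.

Lemma twisted_sum_newton eta n : twisted_sum eta n.+1 =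
  \sum_(j < n.+1) (-1) ^+ (eta * j)%N * (n ^_ j)%:R * psum phi j.+1
     * twisted_sum eta (n - j).
Proof.
apply: fpsP => m; rewrite (twisted_sum_trunc _ _ (leqnn m)).
rewrite perm_sum_newton; last exact: lmatrix_homog; last exact: lmatrixM.
rewrite !fcoef_sum; apply: eq_bigr => j _; rewrite -!mulrA !fcoef_signM.
congr (_ * _); rewrite !mulr_natl !fcoefMn; congr (_ *+ _).
rewrite !fcoefM; apply: eq_bigr => i _; have le_im : (i <= m)%N by rewrite -ltnS.
by rewrite strace_lmatrix // (twisted_sum_trunc _ _ (leq_subr i m)).
Qed.

Definition twisted_series eta : fps (fps k) :=
  Fps (fun n => fpsC (n`!%:R^-1) * twisted_sum eta n).

Definition power_series (eta : bool) : fps (fps k) :=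
  Fps (fun l => if l is j.+1 then (-1) ^+ (eta * j)%N * psum phi j.+1 else 0).

Lemma tderiv_twisted eta :
  tderiv (twisted_series eta) = power_series eta * twisted_series eta.
Proof.
have nz n : n`!%:R != 0 :> k by rewrite ((pcharf0P k).1 hk) -lt0n fact_gt0.
apply: fpsP => n; rewrite fcoefM big_ord_recl [fcoef (power_series _) _]/= mul0r add0r.
rewrite [LHS]/=; case: n => [|n]; first by rewrite big_ord0 mulr0n.
rewrite twisted_sum_newton mulr_sumr -sumrMnl; apply: eq_bigr => j _.
rewrite /= /bump /= add0n add1n subSS.
have le_jn : (j <= n)%N by rewrite -ltnS.
have -> : fpsC (n - j)`!%:R^-1 = fpsC (n.+1`!%:R^-1) * (n.+1)%:R * (n ^_ j)%:R :> fps k.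
  rewrite -!(rmorph_nat (@fpsC k)) -!rmorphM; congr fpsC.
  have nzj : (n ^_ j)%:R != 0 :> k by rewrite ((pcharf0P k).1 hk) -lt0n ffact_gt0.
  rewrite factS -(ffact_fact le_jn) !natrM !invfM.
  have nzn : n.+1%:R != 0 :> k by rewrite ((pcharf0P k).1 hk).
  by field; rewrite nz nzj nat1r nzn.
by rewrite -mulr_natl; ring.
Qed.

Lemma twisted_series0 eta : fcoef (twisted_series eta) 0 = 1.
Proof. by rewrite /= fact0 invr1 mulr1. Qed.

Lemma subst_opp_power eta :
  subst_opp (power_series eta) = - power_series (~~ eta).
Proof.
apply: fpsP => -[|j]; rewrite /= ?mulr0 ?oppr0 //.
rewrite mulrA -mulNr; congr (_ * _).
by case: eta; rewrite /= ?mul0n ?mul1n ?mulr1 exprS -?mulrA -?expr2 ?sqrr_sign ?mulN1r.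
Qed.

(** The two logarithmic derivatives are opposite by [subst_opp_power]. *)
Lemma twisted_inverse :
  subst_opp (twisted_series false) * twisted_series true = 1.
Proof.
apply: (tderiv_uniq hk (P := 0)); rewrite ?fcoef0M ?fcoef1 ?tderiv1 ?mul0r //.
  by rewrite subst_opp0 !twisted_series0 mulr1.
rewrite tderivM tderiv_subst_opp !tderiv_twisted rmorphM /= subst_opp_power.
by ring.
Qed.

Lemma twisted_series1 eta : fcoef (twisted_series eta) 1 = lefschetz phi.
Proof.
have : fcoef (tderiv (twisted_series eta)) 1 = lefschetz phi.
  rewrite tderiv_twisted fcoefM big_ord_recl big_ord1 !twisted_series0 mulr1.
  rewrite [fcoef (power_series _) 0]/= mul0r add0r /= muln0 mul1r.
  apply: fpsP => m /=; rewrite big_mkcond big_ord_recr /= mul1n eqxx comp_lfun1r.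
  by rewrite big1 ?add0r // => i _; rewrite mul1n ltn_eqF.
by [].
Qed.

Lemma Sym_series :
  lefschetz_series cp phi (fun n => ('Sym_('I_n))%g) = twisted_series false.
Proof.
apply: fpsP => -[|n]; first by rewrite twisted_series0.
rewrite [LHS]/= (lefschetz_invariants ('Sym_('I_n.+1))%G) card_Sym card_ord.
rewrite /=; congr (_ * _); apply: eq_big => g; first by rewrite inE.
by rewrite mul1r.
Qed.

(** Restricting a sum to even permutations amounts to averaging [1] and the sign.
    The bound on [n] is where [A_n] has index two in [S_n]. *)
Lemma Alt_series_ge2 n :
  fcoef (lefschetz_series cp phi (fun n => ('Alt_('I_n))%g)) n.+2 =
  fcoef (twisted_series false) n.+2 + fcoef (twisted_series true) n.+2.
Proof.
have card2 : (2 * #|('Alt_('I_n.+2))%g| = n.+2`!)%N by rewrite card_Alt card_ord.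
have nz2 : 2%:R != 0 :> k by rewrite ((pcharf0P k).1 hk).
rewrite [LHS]/= (lefschetz_invariants ('Alt_('I_n.+2))%G) /=.
rewrite -mulrDr -big_split /= -card2 natrM invfM rmorphM.
have -> : \sum_(g : 'S_n.+2) ((-1) ^+ (false && odd_perm g) * perm_lefschetz g +
      (-1) ^+ (true && odd_perm g) * perm_lefschetz g) =
    fpsC 2%:R * \sum_(g in ('Alt_('I_n.+2))%g) perm_lefschetz g.
  rewrite mulr_sumr [RHS]big_mkcond; apply: eq_bigr => g _ /=.
  rewrite Alt_even mul1r rmorph_nat.
  by case: (odd_perm g); rewrite ?mulN1r ?subrr // mul1r -mulr2n mulr_natl.
by rewrite mulrACA -rmorphM mulVf // rmorph1 mul1r.
Qed.

Lemma Alt_series : let A := lefschetz_series cp phi (fun n => ('Alt_('I_n))%g) in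
  A = twisted_series false + twisted_series true - 1 - fpsC (lefschetz phi) * fpsX.
Proof.
move=> A; apply: fpsP => n.
rewrite !fcoefB fcoefD fcoefCM fcoef1.
case: n => [|[|n]]; last by rewrite /A Alt_series_ge2 /= mulr0 !subr0.
  by rewrite !twisted_series0 /= mulr0 subr0 addrK.
have -> : fcoef A 1 = fcoef (lefschetz_series cp phi (fun n => ('Sym_('I_n))%g)) 1.
  rewrite /= (_ : ('Alt_('I_1))%g = ('Sym_('I_1))%g) //.
  apply/setP => g; rewrite (_ : g = 1%g) ?group1 //.
  by apply/permP => i; rewrite !ord1.
by rewrite Sym_series !twisted_series1 /= mulr1 subr0 addrK.
Qed.

Definition char_factor i : fps (fps k) :=
  \det (charseries (fpsX ^+ i *: map_mx (@fpsC k) (end_mx (phi i)))).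

Lemma scale_fps_mx i :
  ((fpsC fpsX : fps (fps k)) ^+ i * fpsX) *: fps_mx (phi i) =
  fpsX *: map_mx (@fpsC (fps k)) (fpsX ^+ i *: map_mx (@fpsC k) (end_mx (phi i))).
Proof.
rewrite /fps_mx (map_mx_comp (@fpsC k) (@fpsC (fps k))) map_mxZ !scalerA.
by rewrite rmorphXn mulrC.
Qed.

Lemma char_factorE i :
  \det (1%:M - ((fpsC fpsX : fps (fps k)) ^+ i * fpsX) *: fps_mx (phi i)) = char_factor i.
Proof. by rewrite scale_fps_mx. Qed.

Lemma char_factor_oppE i :
  \det (1%:M + ((fpsC fpsX : fps (fps k)) ^+ i * fpsX) *: fps_mx (phi i)) =
  subst_opp (char_factor i).
Proof.
rewrite scale_fps_mx /char_factor -det_map_mx; congr (\det _).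
by rewrite charseries_opp.
Qed.

Lemma trseries_end i : trseries (fpsX ^+ i *: map_mx (@fpsC k) (end_mx (phi i))) =
  Fps (fun l => if l is j.+1
                then fpsX ^+ (j.+1 * i)%N * fpsC (ltrace (lpow (phi i) j.+1)) else 0).
Proof.
have powE l : mxpow (fpsX ^+ i *: map_mx (@fpsC k) (end_mx (phi i))) l =
    fpsX ^+ (l * i)%N *: map_mx (@fpsC k) (end_mx (lpow (phi i) l)).
  elim: l => [|l IH].
    by rewrite /end_mx passmx.mxof1 ?(basis_free (vbasisP _)) // map_mx1 scale1r.
  rewrite /= IH -scalemxAl -scalemxAr scalerA -map_mxM -exprD addnC -mulSn.
  by rewrite /end_mx (passmx.mxof_comp _ _ (vbasisP _)).
apply: fpsP => -[//|l]; have := congr1 mxtrace (powE l.+1).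
by rewrite mxtraceZ trace_map_mx.
Qed.

(** [b = 0] and [b = 1] give the two exponents [(-1)^i] and [(-1)^(i+1)]. *)
Definition char_product d (f : nat -> fps (fps k)) (b : nat) : fps (fps k) :=
  \prod_(i < (2 * d).+1) (1 / f i) ^ ((-1) ^+ (i + b)%N : int).

Section Vanishing.
Variable d : nat.
Hypothesis Hd : forall i, (2 * d < i)%N -> \dim {: H X i} = 0%N.

Lemma ltrace_vanish i (f : 'End(H X i)) : (2 * d < i)%N -> ltrace f = 0.
Proof.
by move=> /Hd di; rewrite ltrace_coord big1 // => -[a lt_a]; exfalso; rewrite di in lt_a.
Qed.

Lemma power_series_sum :
  power_series false = \sum_(i < (2 * d).+1) (-1) ^+ i *
    trseries (fpsX ^+ i *: map_mx (@fpsC k) (end_mx (phi i))).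
Proof.
apply: fpsP => l; rewrite fcoef_sum.
under eq_bigr => i _ do rewrite fcoef_signM trseries_end.
case: l => [|l] /=; first by rewrite big1 // => i _; rewrite mulr0.
rewrite mul1r; apply: fpsP => m; rewrite fcoef_sum.
pose F i : k := if (l.+1 * i == m)%N then (-1) ^+ i * ltrace (lpow (phi i) l.+1) else 0.
have -> : \sum_(i < (2 * d).+1) fcoef ((-1) ^+ i *
      (fpsX ^+ (l.+1 * i)%N * fpsC (ltrace (lpow (phi i) l.+1)))) m =
    \sum_(i < (2 * d).+1) F i.
  apply: eq_bigr => i _; rewrite fcoef_signM fcoefXnC /F.
  by case: eqP => // _; rewrite mulr0.
rewrite [LHS]/= big_mkcond -/(F _) /=.
have Fm i : (m < i)%N -> F i = 0.
  move=> lt_mi; rewrite /F gtn_eqF //; apply: leq_trans lt_mi _; exact: leq_pmull.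
have Fd i : (2 * d < i)%N -> F i = 0.
  by move=> lt_di; rewrite /F ltrace_vanish // mulr0 if_same.
pose M := maxn m.+1 (2 * d).+1.
have ext a : (a <= M)%N -> (forall i, (a <= i)%N -> F i = 0) ->
    \sum_(i < a) F i = \sum_(i < M) F i.
  move=> le_aM F0; rewrite (big_ord_widen M F le_aM) big_mkcond; apply: eq_bigr => i _.
  by case: ltnP => // /F0 ->.
by rewrite (ext m.+1) ?leq_maxl // (ext (2 * d).+1) ?leq_maxr.
Qed.

Lemma tderiv_factor (f Q : fps (fps k)) i : f \is a GRing.unit -> tderiv f = - Q * f ->
  tderiv ((1 / f) ^ ((-1) ^+ i : int)) = (-1) ^+ i * Q * (1 / f) ^ ((-1) ^+ i : int).
Proof.
move=> Uf df; rewrite div1r -!(signr_odd _ i); case: (odd i); rewrite ?expr1 ?expr0.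
  by rewrite exprN1 invrK df mulN1r.
rewrite expr1z mul1r; apply: (mulIr Uf); apply: (addIr (f^-1 * tderiv f)).
rewrite -tderivM mulVr // tderiv1 df.
by ring.
Qed.

Lemma const_coef_factor (f : fps (fps k)) i : f \is a GRing.unit -> fcoef f 0 = 1 ->
  const_coef ((1 / f) ^ ((-1) ^+ i : int)) = 1.
Proof.
move=> Uf f0; rewrite div1r -(signr_odd _ i); case: (odd i); rewrite ?expr1 ?expr0.
  by rewrite exprN1 invrK.
by rewrite expr1z rmorphV //= (f0 : const_coef f = 1) invr1.
Qed.

(** Both sides solve [t F' = P F] with constant term [1]: the logarithmic derivative
    of the [i]-th factor is [(-1)^i sum_(l > 0) tr(phi_i^l) u^(i l) t^l]. *)
Lemma char_product_series : char_product d char_factor 0 = twisted_series false.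
Proof.
apply: (tderiv_uniq hk (P := power_series false)) => //.
- rewrite twisted_series0 -[LHS]/(const_coef _) rmorph_prod big1 // => i _.
  by apply: const_coef_factor; [apply: charseries_unit | apply: charseries0].
- rewrite /char_product tderiv_prod power_series_sum mulr_suml; apply: eq_bigr => i _.
  rewrite (@tderiv_factor _ (trseries (fpsX ^+ i *: map_mx (@fpsC k) (end_mx (phi i))))).
  + by rewrite addn0 [in RHS](bigD1 i) //= addn0 !mulrA.
  + exact: charseries_unit.
  + exact: tderiv_charseries.
- exact: tderiv_twisted.
Qed.

Lemma char_product_opp :
  subst_opp (char_product d char_factor 0) *
  char_product d (fun i => subst_opp (char_factor i)) 1 = 1.
Proof.
rewrite /char_product rmorph_prod -big_split big1 //= => i _.
have U : char_factor i \is a GRing.unit by apply: charseries_unit.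
have U' : subst_opp (char_factor i) \is a GRing.unit by apply: rmorph_unit.
rewrite !div1r addn0 addn1 exprS -!(signr_odd _ i).
case: (odd i); rewrite ?expr1 ?expr0 ?mulN1r ?opprK ?mulr1 expr1z exprN1.
  by rewrite invrK mulrV.
by rewrite invrK rmorphV // mulVr.
Qed.

End Vanishing.

(** A partial sum of the dimensions of maximal value cannot be enlarged by a later
    degree. *)
Lemma dim_finite_vanish : dim_finite (H X) ->
  exists d : nat, forall i, (2 * d < i)%N -> \dim {: H X i} = 0%N.
Proof.
case=> N leN.
pose P s := `[< exists m, (\sum_(i < m) \dim {: H X i})%N = s >].
have exP : exists s, P s by exists 0; apply/asboolP; exists 0; rewrite big_ord0.
have ubP s : P s -> (s <= N)%N by move=> /asboolP[m <-].
case: (ex_maxnP exP ubP) => s /asboolP[m sE] maxs.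
exists m => i lt_i; apply/eqP; rewrite -leqn0 -(leq_add2l s) addn0.
have le_mi : (m <= i)%N by apply: leq_trans (ltnW lt_i); rewrite leq_pmull.
apply: leq_trans (maxs (\sum_(j < i.+1) \dim {: H X j})%N _); last first.
  by apply/asboolP; exists i.+1.
rewrite big_ord_recr /= leq_add2r -sE.
rewrite (big_ord_widen i (fun j => \dim {: H X j}) le_mi) big_mkcond.
by apply: leq_sum => j _; case: ifP.
Qed.

End Assembly.

Theorem corollary4p3 (C : fpCategory) (k : fieldType) (hk : [pchar k] =i pred0)
    (H : cohFunctor C k) (cp : cupProduct H) (hkun : kunneth cp)
    (X : C) (phi : grhom (H X) (H X)) :
  let A := lefschetz_series cp phi (fun n => ('Alt_('I_n))%g) in
  let S := lefschetz_series cp phi (fun n => ('Sym_('I_n))%g) in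
  let u : fps (fps k) := fpsC fpsX in
  let t : fps (fps k) := fpsX in
  let L : fps (fps k) := fpsC (lefschetz phi) in
  A = S + 1 / subst_opp S - 1 - L * t
  /\
  (dim_finite (H X) ->
    (exists d : nat, forall i, (2 * d < i)%N -> \dim {: H X i} = 0%N) /\
    forall d : nat, (forall i, (2 * d < i)%N -> \dim {: H X i} = 0%N) ->
      A = \prod_(i < (2 * d).+1)
            (1 / \det (1%:M - (u ^+ i * t) *: fps_mx (phi i))) ^ ((-1) ^+ i : int)
        + \prod_(i < (2 * d).+1)
            (1 / \det (1%:M + (u ^+ i * t) *: fps_mx (phi i))) ^ ((-1) ^+ i.+1 : int)
        - 1 - L * t).
Proof.
move=> A S u t L.
have AE : A = twisted_series cp phi false + twisted_series cp phi true - 1 - L * t.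
  exact: Alt_series.
have SE : S = twisted_series cp phi false by apply: Sym_series.
have inv := twisted_inverse hk hkun phi.
have U : subst_opp (twisted_series cp phi false) \is a GRing.unit.
  by apply/unitrPr; exists (twisted_series cp phi true).
have TE : twisted_series cp phi true = 1 / subst_opp S.
  by rewrite SE -inv mulrC mulKr.
split; first by rewrite AE TE SE.
move=> fin; split=> [|d Hd]; first exact: dim_finite_vanish.
rewrite AE; congr (_ + _ - 1 - _).
  rewrite -(char_product_series hk hkun phi Hd); apply: eq_bigr => i _.
  by rewrite char_factorE addn0.
apply: (mulrI U); rewrite inv -[LHS](char_product_opp phi d) (char_product_series hk hkun) //.
congr (_ * _); apply: eq_bigr => i _.
by rewrite char_factor_oppE addn1.
Qed.
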